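(* Let $h=(h_{11})$ be a semi-Riemannian metric on $\mathbb{R}$ and let $RL^n=(J^1(\mathbb{R},M),L)$ be a relativistic rheonomic Lagrange space, i.e. $L$ is a Kronecker $h$-regular Lagrangian function on $E=J^1(\mathbb{R},M)$. Let $(H,G)$ be the canonical time-dependent spray of $RL^n$, with components $H^{(i)}_{(1)1}$ and $G^{(i)}_{(1)1}$. Then the pair of local functions $\Gamma=(M^{(i)}_{(1)1},N^{(i)}_{(1)j})$ consisting of the temporal components $$M^{(i)}_{(1)1}=2H^{(i)}_{(1)1}=-H^1_{11}y^i$$ and the spatial components $$N^{(i)}_{(1)j}=\frac{\partial G^{(i)}_{(1)1}}{\partial y^j}$$ represents a nonlinear connection on $J^1(\mathbb{R},M)$.
   Context: $M$ is a smooth $n$-dimensional manifold; $E=J^1(\mathbb{R},M)\equiv\mathbb{R}\times TM$ has local coordinates $(t,x^i,y^i)$, latin indices run from $1$ to $n$, the index $1$ refers to the time axis, and repeated latin indices are summed. Coordinate changes on $E$ are $\tilde t=\tilde t(t)$, $\tilde x^i=\tilde x^i(x^j)$, $\tilde y^i=\frac{\partial\tilde x^i}{\partial x^j}\frac{dt}{d\tilde t}y^j$; the derivatives $\partial\tilde y^j/\partial t$, $\partial\tilde y^j/\partial x^i$ are taken from this formula as functions of $(t,x,y)$. $h=(h_{11}(t))$ is a semi-Riemannian metric on $\mathbb{R}$ (smooth, nowhere zero, $\tilde h_{11}=h_{11}(dt/d\tilde t)^2$), $h^{11}=1/h_{11}$, $H^1_{11}=\frac{h^{11}}{2}\frac{dh_{11}}{dt}$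 its Christoffel symbol. A smooth $L:E\to\mathbb{R}$ is a Kronecker $h$-regular Lagrangian function if $\frac12\frac{\partial^2L}{\partial y^i\partial y^j}=h^{11}(t)g_{ij}(t,x^k,y^k)$, where $g_{ij}$ is symmetric, of rank $n$, of constant signature, and is a d-tensor, i.e. $\tilde g_{ij}=\frac{\partial x^k}{\partial\tilde x^i}\frac{\partial x^l}{\partial\tilde x^j}g_{kl}$. $(g^{ij})$ is the inverse matrix of $(g_{ij})$. The pair $(J^1(\mathbb{R},M),L)$ is then called a relativistic rheonomic Lagrange space. The canonical time-dependent spray of $RL^n$ has components $H^{(i)}_{(1)1}=-\frac12H^1_{11}y^i$ and $$G^{(i)}_{(1)1}=\frac{h_{11}g^{ik}}{4}\left[\frac{\partial^2L}{\partial x^j\partial y^k}y^j-\frac{\partial L}{\partial x^k}+\frac{\partial^2L}{\partial t\partial y^k}+\frac{\partial L}{\partial y^k}H^1_{11}+2h^{11}H^1_{11}g_{kl}y^l\right].$$ A nonlinear connection on $E$ is given by a pair of sets of local functions $(M^{(i)}_{(1)1},N^{(i)}_{(1)j})$, defined in each coordinate chart, which transform by $$\tilde M^{(j)}_{(1)1}\frac{d\tilde t}{dt}=M^{(k)}_{(1)1}\frac{dt}{d\tilde t}\frac{\partial\tilde x^j}{\partial x^k}-\frac{\partial\tilde y^j}{\partial t},\qquad \tilde N^{(j)}_{(1)k}\frac{\partial\tilde x^k}{\partial x^i}=N^{(k)}_{(1)i}\frac{dt}{d\tilde t}\frac{\partial\tilde x^j}{\partial x^k}-\frac{\partial\tilde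 y^j}{\partial x^i}.$$ *)

(* Defs.v *)
From HB Require Import structures.
From mathcomp Require Import all_boot all_order all_algebra.
From mathcomp Require Import all_classical all_reals all_analysis.

Set Implicit Arguments.
Unset Strict Implicit.
Unset Printing Implicit Defensive.

Import Order.TTheory GRing.Theory Num.Theory.
Import numFieldNormedType.Exports.

Local Open Scope classical_set_scope.
Local Open Scope ring_scope.

(* [U] is meant to be open: all limits are taken in the ambient space.        *)
Fixpoint Ck_on (R : realType) (V W : normedModType R) (k : nat) (U : set V)
    (f : V -> W) : Prop :=
  if k is k'.+1 then
    (forall x, U x -> differentiable f x) /\
    (forall v : V, Ck_on k' U (fun x => 'D_v f x))
  else forall x, U x -> {for x, continuous f}.

Definition smooth_on (R : realType) (V W : normedModType R) (U : set V)
  (f : V -> W) : Prop := forall k, Ck_on k U f.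

(* A chart is a homeomorphism between the open sets [cdom] and [cran];        *)
(* [cmap] and [cinv] carry junk values outside these sets.                    *)
Record chart (R : realType) (V : normedModType R) (M : topologicalType) :=
  Chart {
    cdom : set M;
    cmap :> M -> V;
    cinv : V -> M;
    open_cdom : open cdom;
    open_cran : open (cmap @` cdom);
    cmapK : forall p, cdom p -> cinv (cmap p) = p;
    cmap_continuous : forall p, cdom p -> {for p, continuous cmap};
    cinv_continuous : forall x, (cmap @` cdom) x -> {for x, continuous cinv}
  }.

Definition cran (R : realType) (V : normedModType R) (M : topologicalType)
  (c : chart V M) : set V := c @` cdom c.

Definition overlap (R : realType) (V : normedModType R) (M : topologicalType)
  (c c' : chart V M) : set V := c @` (cdom c `&` cdom c').

Definition trans (R : realType) (V : normedModType R) (M : topologicalType)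
  (c c' : chart V M) : V -> V := fun x => c' (cinv c x).

Definition compatible (R : realType) (V : normedModType R)
    (M : topologicalType) (c c' : chart V M) : Prop :=
  smooth_on (overlap c c') (trans c c') /\
  smooth_on (overlap c' c) (trans c' c).

Record smooth_manifold (R : realType) (n : nat) := SmoothManifold {
  carrier :> topologicalType;
  manifold_hausdorff : hausdorff_space carrier;
  manifold_second_countable : @second_countable carrier;
  atlas : set (chart 'rV[R]_n carrier);
  atlas_cover : forall p : carrier, exists c, atlas c /\ cdom c p;
  atlas_compatible : forall c c', atlas c -> atlas c' -> compatible c c';
  atlas_maximal : forall c,
    (forall c', atlas c' -> compatible c c') -> atlas c
}.

(* A chart of the maximal atlas of the real line. *)
Definition time_chart (R : realType) := chart (R : normedModType R) R.

Definition time_coord (R : realType) (tau : time_chart R) : Prop :=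
  smooth_on (cdom tau) tau /\ smooth_on (cran tau) (cinv tau).

(* [dtrans tau tau' s] is the derivative of the new time coordinate with      *)
(* respect to the old one, at the point whose old coordinate is [s].          *)
Definition dtrans (R : realType) (tau tau' : time_chart R) (s : R) : R :=
  derive1 (trans tau tau') s.

(* Row vectors are multiplied on the left of the Jacobian matrix:             *)
(* [jac c c' x k j] is d x'^j / d x^k.                                        *)
Definition jac (R : realType) (n : nat) (M : topologicalType)
    (c c' : chart 'rV[R]_n M) (x : 'rV[R]_n) : 'M[R]_n :=
  jacobian (trans c c') x.

Definition chart_at (R : realType) (n : nat) (M : smooth_manifold R n) (p : M) :
  chart 'rV[R]_n M := projT1 (cid (atlas_cover p)).

(* A tangent vector at [tbase] is encoded by its components [tcomp] in the    *)
(* preferred chart [chart_at tbase]; its components in any other chart [c]    *)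
(* around [tbase] are obtained by multiplication with the Jacobian matrix     *)
(* of the change of coordinates from [chart_at tbase] to [c].                 *)
Record tangent_bundle (R : realType) (n : nat) (M : smooth_manifold R n) :=
  Tangent { tbase : M; tcomp : 'rV[R]_n }.

Definition jet_space (R : realType) (n : nat) (M : smooth_manifold R n) : Type :=
  (R * tangent_bundle M)%type.

(* Coordinates (t, x, y) of a jet are [((t, x), y)]. *)
Definition jcoords (R : realType) (n : nat) : normedModType R :=
  (R * 'rV[R]_n * 'rV[R]_n)%type.

Definition jran (R : realType) (n : nat) (M : smooth_manifold R n)
    (tau : time_chart R) (c : chart 'rV[R]_n M) : set (jcoords R n) :=
  [set z | cran tau z.1.1 /\ cran c z.1.2].

Definition joverlap (R : realType) (n : nat) (M : smooth_manifold R n)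
    (tau : time_chart R) (c : chart 'rV[R]_n M)
    (tau' : time_chart R) (c' : chart 'rV[R]_n M) : set (jcoords R n) :=
  [set z | overlap tau tau' z.1.1 /\ overlap c c' z.1.2].

(* The jet with coordinates [z] in the chart induced by [tau] and [c]. The    *)
(* fibre coordinate of the jet of a curve is its velocity d(c o curve)/d tau; *)
(* the factor [derive1 tau] turns it into the velocity with respect to the    *)
(* standard parameter of the real line.                                       *)
Definition jpoint (R : realType) (n : nat) (M : smooth_manifold R n)
    (tau : time_chart R) (c : chart 'rV[R]_n M) (z : jcoords R n) :
    jet_space M :=
  let t := cinv tau z.1.1 in
  let p := cinv c z.1.2 in
  (t, @Tangent R n M p
        (derive1 tau t *: (z.2 *m jac c (chart_at p) z.1.2))).

Definition loc (R : realType) (n : nat) (M : smooth_manifold R n)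
    (L : jet_space M -> R) (tau : time_chart R) (c : chart 'rV[R]_n M) :
    jcoords R n -> R :=
  fun z => L (jpoint tau c z).

Definition smooth_on_jets (R : realType) (n : nat) (M : smooth_manifold R n)
    (L : jet_space M -> R) : Prop :=
  forall tau c, time_coord tau -> atlas c ->
    smooth_on (jran tau c) (loc L tau c).

Definition new_y (R : realType) (n : nat) (M : smooth_manifold R n)
    (tau : time_chart R) (c : chart 'rV[R]_n M)
    (tau' : time_chart R) (c' : chart 'rV[R]_n M) (z : jcoords R n) :
    'rV[R]_n :=
  \row_j \sum_(i < n)
     jac c c' z.1.2 i j * dtrans tau' tau (trans tau tau' z.1.1) * z.2 0 i.

Definition jtrans (R : realType) (n : nat) (M : smooth_manifold R n)
    (tau : time_chart R) (c : chart 'rV[R]_n M)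
    (tau' : time_chart R) (c' : chart 'rV[R]_n M) (z : jcoords R n) :
    jcoords R n :=
  (trans tau tau' z.1.1, trans c c' z.1.2, new_y tau c tau' c' z).

Definition pd_t (R : realType) (n : nat) (f : jcoords R n -> R)
    (z : jcoords R n) : R :=
  'D_((1, 0, 0) : jcoords R n) f z.

Definition pd_x (R : realType) (n : nat) (i : 'I_n) (f : jcoords R n -> R)
    (z : jcoords R n) : R :=
  'D_((0, delta_mx 0 i, 0) : jcoords R n) f z.

Definition pd_y (R : realType) (n : nat) (i : 'I_n) (f : jcoords R n -> R)
    (z : jcoords R n) : R :=
  'D_((0, 0, delta_mx 0 i) : jcoords R n) f z.

Definition semi_riemannian_metric (R : realType)
    (h : time_chart R -> R -> R) : Prop :=
  (forall tau, time_coord tau ->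
     smooth_on (cran tau) (h tau) /\ (forall s, cran tau s -> h tau s != 0)) /\
  (forall tau tau', time_coord tau -> time_coord tau' ->
     forall s, overlap tau tau' s ->
       let s' := trans tau tau' s in
       h tau' s' = h tau s * dtrans tau' tau s' ^+ 2).

Definition christoffel (R : realType) (h : time_chart R -> R -> R)
    (tau : time_chart R) (s : R) : R :=
  (h tau s)^-1 / 2 * derive1 (h tau) s.

Definition has_signature (R : realType) (n : nat) (A : 'M[R]_n)
    (p q : nat) : Prop :=
  (p + q <= n)%N /\
  exists2 P : 'M[R]_n, P \in unitmx &
    P *m A *m P^T =
    diag_mx (\row_(i < n) (if (i < p)%N then 1
                           else if (i < p + q)%N then -1 else 0)).

(* A family of local functions indexed by the charts of the jet space. *)
Definition local_family (R : realType) (n : nat) (M : smooth_manifold R n)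
    (T : Type) : Type :=
  time_chart R -> chart 'rV[R]_n M -> jcoords R n -> T.

Definition d_tensor02 (R : realType) (n : nat) (M : smooth_manifold R n)
    (g : local_family M 'M[R]_n) : Prop :=
  forall tau c tau' c',
    time_coord tau -> atlas c -> time_coord tau' -> atlas c' ->
    forall z, joverlap tau c tau' c' z ->
      let z' := jtrans tau c tau' c' z in
      forall i j,
        g tau' c' z' i j =
        \sum_(k < n) \sum_(l < n)
          jac c' c z'.1.2 i k * jac c' c z'.1.2 j l * g tau c z k l.

Definition kronecker_h_regular (R : realType) (n : nat)
    (M : smooth_manifold R n) (h : time_chart R -> R -> R)
    (L : jet_space M -> R) (g : local_family M 'M[R]_n) : Prop :=
  [/\ smooth_on_jets L,
      forall tau c, time_coord tau -> atlas c ->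
        forall z, jran tau c z ->
          (forall i j, 2^-1 * pd_y i (pd_y j (loc L tau c)) z =
                       (h tau z.1.1)^-1 * g tau c z i j) /\
          (forall i j, g tau c z i j = g tau c z j i) /\
          \rank (g tau c z) = n,
      exists p q, forall tau c, time_coord tau -> atlas c ->
        forall z, jran tau c z -> has_signature (g tau c z) p q &
      d_tensor02 g].

Definition spray_H (R : realType) (n : nat) (M : smooth_manifold R n)
    (h : time_chart R -> R -> R) : local_family M 'rV[R]_n :=
  fun tau c z => \row_i (- 2^-1 * christoffel h tau z.1.1 * z.2 0 i).

Definition spray_G (R : realType) (n : nat) (M : smooth_manifold R n)
    (h : time_chart R -> R -> R) (L : jet_space M -> R)
    (g : local_family M 'M[R]_n) : local_family M 'rV[R]_n :=
  fun tau c z =>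
    let l := loc L tau c in
    let h11 := h tau z.1.1 in
    let H := christoffel h tau z.1.1 in
    \row_i \sum_(k < n)
      h11 * invmx (g tau c z) i k / 4 *
      (\sum_(j < n) pd_x j (pd_y k l) z * z.2 0 j
       - pd_x k l z
       + pd_t (pd_y k l) z
       + pd_y k l z * H
       + 2 * h11^-1 * H * \sum_(m < n) g tau c z k m * z.2 0 m).

(* [Mt tau c z 0 i] and [Ns tau c z i j] are the temporal component of upper  *)
(* index i and the spatial component of upper index i and lower index j.      *)
Definition nonlinear_connection (R : realType) (n : nat)
    (M : smooth_manifold R n)
    (Mt : local_family M 'rV[R]_n) (Ns : local_family M 'M[R]_n) : Prop :=
  forall tau c tau' c',
    time_coord tau -> atlas c -> time_coord tau' -> atlas c' ->
    forall z, joverlap tau c tau' c' z ->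
      let z' := jtrans tau c tau' c' z in
      let y' (j : 'I_n) := fun w => new_y tau c tau' c' w 0 j in
      let dt'dt := dtrans tau tau' z.1.1 in
      let dtdt' := dtrans tau' tau z'.1.1 in
      let J := jac c c' z.1.2 in
      (forall j, Mt tau' c' z' 0 j * dt'dt =
         \sum_(k < n) Mt tau c z 0 k * dtdt' * J k j - pd_t (y' j) z) /\
      (forall i j, \sum_(k < n) Ns tau' c' z' j k * J i k =
         \sum_(k < n) Ns tau c z k i * dtdt' * J k j - pd_x i (y' j) z).

(* Main.v *)
Require Import Defs.
From HB Require Import structures.
From mathcomp Require Import all_boot all_order all_algebra.
From mathcomp Require Import all_classical all_reals all_analysis.
From mathcomp Require Import ring.

Import Order.TTheory GRing.Theory Num.Theory.
Import numFieldNormedType.Exports.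

Local Open Scope classical_set_scope.
Local Open Scope ring_scope.

(* Write a = dt/dt', J for the Jacobian matrix of x' and
   q^p = (d^2 x'^p / dx^i dx^k) y^i y^k, and let E_k be the bracket in the
   definition of the spray. Since 2 h^11 g_kl is the Hessian of L in y, E_k is
   D_S (dL/dy^k) - dL/dx^k + H dL/dy^k for the direction S = (1, y, H y).
   The law H' = a H + da/dt makes the push-forward of S equal to
   (dt'/dt) S' + (0, 0, a q), and the symmetry of the second derivatives of x'
   cancels the terms containing them in d/dx^k, so that
   E_k = J_k^m (E'_m + a^2 q^p d^2L/dy'^p dy'^m). Contracting with g^-1 gives
   G' = a^2 (J G - q / 2); differentiating this in y^i, where
   dq/dy^i = 2 (d^2 x' / dx^i dx^k) y^k, gives the transformation law of the
   spatial components. *)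

(** * Differential calculus *)

(** The term q/2 in the law of G comes from multiplying the factor 2/h'_11 of the Hessian by the
    h'_11/4 in front of the spray. The inverse metric cancels the g' that accompanies q, so the
    defect of G depends on the change of coordinates alone and its y-derivative involves no
    derivative of the metric. Writing E_k with one directional derivative means that a single
    application of the chain rule to dL/dy^k replaces the separate transformation of three kinds of
    second derivatives of L. The main obstacle is that charts, and hence all local functions, have
    junk values off their domains: the identities hold only on open overlaps, and each
    differentiation must be justified by agreement near the point. The calculation is therefore done
    for abstract data [th], [a], [ph], [J] on an open set, and transition maps enter only at the
    end. *)

Section differentiability.
Set Implicit Arguments.
Unset Strict Implicit.
Context {R : realType}.
Implicit Types V W : normedModType R.

(** Local identities between functions with junk values are differentiated through this lemma. The
    differential of [f] also gives the first-order expansion of [g], and uniqueness of such an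
    expansion makes it the differential of [g]. *)
Lemma near_eq_differentiable V W (f g : V -> W) (x : V) :
  {near x, f =1 g} -> differentiable f x -> differentiable g x.
Proof.
move=> fg df; have [dc dE] := (diff_locallyP x f).1 df.
have gE : g \o shift x = cst (g x) + 'd f x +o_ 0 id.
  apply/eqaddoP => e e0.
  have /eqaddoP/(_ e e0) fe := dE.
  have fg0 : \forall y \near (0 : V), f (y + x) = g (y + x).
    by move: fg; rewrite (near_shift 0) subr0.
  apply: filterS2 fe fg0 => y; rewrite /= !fctE/= => fe fgy.
  by rewrite -fgy -(nbhs_singleton fg).
have dgf : 'd g x = 'd f x :> (V -> W) by exact: diff_unique.
by apply/diff_locallyP; rewrite dgf.
Qed.

Lemma derive_comp V1 V W (g : V1 -> V) (f : V -> W) (x v : V1) :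
  differentiable g x -> differentiable f (g x) ->
  'D_v (f \o g) x = 'D_('D_v g x) f (g x).
Proof.
move=> dg df; have dfg : differentiable (f \o g) x by exact: differentiable_comp.
by rewrite (deriveE _ dfg) (deriveE _ dg) (deriveE _ df) diff_comp.
Qed.

Lemma linear_derive V W (f : {linear V -> W}) (x v : V) :
  continuous f -> 'D_v f x = f v.
Proof. by move=> cf; rewrite (deriveE _ (linear_differentiable x cf)) diff_lin. Qed.

Lemma differentiable_fst V W (x : V * W) : differentiable fst x.
Proof. by apply: linear_differentiable => y; exact: cvg_fst. Qed.

Lemma differentiable_snd V W (x : V * W) : differentiable snd x.
Proof. by apply: linear_differentiable => y; exact: cvg_snd. Qed.

Lemma derive_fst V W (x v : V * W) : 'D_v fst x = v.1.
Proof. by apply: linear_derive => y; exact: cvg_fst. Qed.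

Lemma derive_snd V W (x v : V * W) : 'D_v snd x = v.2.
Proof. by apply: linear_derive => y; exact: cvg_snd. Qed.

Lemma derive_pair V V1 V2 (f : V -> V1) (g : V -> V2) (x v : V) :
  differentiable f x -> differentiable g x ->
  'D_v (fun w => (f w, g w)) x = ('D_v f x, 'D_v g x).
Proof.
move=> df dg.
by rewrite (deriveE _ (differentiable_pair df dg)) (deriveE _ df) (deriveE _ dg)
  diff_pair.
Qed.

Lemma differentiable_sumf V W I (r : seq I) (P : pred I) (f : I -> V -> W)
    (x : V) : (forall i, P i -> differentiable (f i) x) ->
  differentiable (fun w => \sum_(i <- r | P i) f i w) x.
Proof.
move=> df; elim: r => [|i r IH].
  by under eq_fun do rewrite big_nil; exact: differentiable_cst.
under eq_fun do rewrite big_cons; case Pi: (P i) => //.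
by apply: (@differentiableD _ _ _ (f i)) => //; exact: df.
Qed.

Lemma derive_sumf V W n (f : 'I_n -> V -> W) (x v : V) :
  (forall i, differentiable (f i) x) ->
  'D_v (fun w => \sum_(i < n) f i w) x = \sum_(i < n) 'D_v (f i) x.
Proof.
by move=> df; rewrite -fct_sumE derive_sum// => i; exact: diff_derivable.
Qed.

Lemma differentiable_addf V W (f g : V -> W) (x : V) :
  differentiable f x -> differentiable g x ->
  differentiable (fun w => f w + g w) x.
Proof. exact: differentiableD. Qed.

Lemma differentiable_oppf V W (f : V -> W) (x : V) :
  differentiable f x -> differentiable (fun w => - f w) x.
Proof. exact: differentiableN. Qed.

Lemma differentiable_mulf V (f g : V -> R) (x : V) :
  differentiable f x -> differentiable g x ->
  differentiable (fun w => f w * g w) x.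
Proof. exact: differentiableM. Qed.

Lemma derive_mulf V (f g : V -> R) (x v : V) :
  differentiable f x -> differentiable g x ->
  'D_v (fun w => f w * g w) x = 'D_v f x * g x + f x * 'D_v g x.
Proof.
move=> df dg; rewrite deriveM; [|exact: diff_derivable..].
by rewrite addrC; congr (_ + _); rewrite /GRing.scale/= mulrC.
Qed.

Lemma derive_linear V W (f : V -> W) (x u v : V) (a : R) :
  differentiable f x -> 'D_(a *: u + v) f x = a *: 'D_u f x + 'D_v f x.
Proof. by move=> df; rewrite !(deriveE _ df) linearP. Qed.

Lemma derive_lincomb V W (f : V -> W) (x : V) n (a : 'I_n -> R) (u : 'I_n -> V) :
  differentiable f x ->
  'D_(\sum_(i < n) a i *: u i) f x = \sum_(i < n) a i *: 'D_(u i) f x.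
Proof.
move=> df; rewrite (deriveE _ df) linear_sum; apply: eq_bigr => i _.
by rewrite linearZ/= (deriveE _ df).
Qed.

Lemma differentiable_mx V m n (f : V -> 'M[R]_(m, n)) (x : V) :
  (forall i j, differentiable (fun w => f w i j) x) -> differentiable f x.
Proof.
move=> df.
have -> : f = fun w => \sum_i \sum_j f w i j *: delta_mx i j.
  by apply/funext => w; exact: matrix_sum_delta.
apply: differentiable_sumf => i _; apply: differentiable_sumf => j _.
exact: differentiableZl.
Qed.

Lemma differentiable_mxE V m n (f : V -> 'M[R]_(m, n)) (x : V) i j :
  differentiable f x -> differentiable (fun w => f w i j) x.
Proof.
move=> df; apply: (@differentiable_comp _ _ _ _ f (fun N => N i j)) => //.
exact: differentiable_coord.
Qed.

Lemma derive_mxE V m n (f : V -> 'M[R]_(m, n)) (x v : V) i j :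
  differentiable f x -> 'D_v (fun w => f w i j) x = 'D_v f x i j.
Proof. by move=> df; rewrite derive_mx ?mxE//; exact: diff_derivable. Qed.

Lemma differentiable_prodf V I (r : seq I) (P : pred I) (f : I -> V -> R)
    (x : V) : (forall i, P i -> differentiable (f i) x) ->
  differentiable (fun w => \prod_(i <- r | P i) f i w) x.
Proof.
move=> df; elim: r => [|i r IH].
  by under eq_fun do rewrite big_nil; exact: differentiable_cst.
under eq_fun do rewrite big_cons; case Pi: (P i) => //.
by apply: (@differentiableM _ _ (f i)) => //; exact: df.
Qed.

Lemma differentiable_det V n (A : V -> 'M[R]_n) (x : V) :
  (forall i j, differentiable (fun w => A w i j) x) ->
  differentiable (fun w => \det (A w)) x.
Proof.
move=> dA; apply: differentiable_sumf => s _.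
apply: differentiable_mulf; first exact: differentiable_cst.
exact: differentiable_prodf.
Qed.

(** Continuity of the determinant keeps the matrices near [x] invertible, and there [invmx] is given
    by the cofactor formula, a quotient of polynomials in the entries. *)
Lemma differentiable_invmx V n (A : V -> 'M[R]_n) (x : V) i j :
  (forall i j, differentiable (fun w => A w i j) x) -> A x \in unitmx ->
  differentiable (fun w => invmx (A w) i j) x.
Proof.
move=> dA; rewrite unitmxE unitfE => Ax.
have ddet := differentiable_det dA.
pose B w := (\det (A w))^-1 * cofactor (A w) j i.
apply: (@near_eq_differentiable _ _ B).
  have : \forall w \near x, \det (A w) != 0.
    exact: cvgr_neq0 (differentiable_continuous ddet) Ax.
  apply: filterS => w Aw.
  by rewrite /B /invmx unitmxE unitfE Aw !mxE.
apply: differentiable_mulf; first exact: (differentiableV ddet).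
apply: differentiable_mulf; first exact: differentiable_cst.
apply: differentiable_det => k l.
by under eq_fun do rewrite !mxE.
Qed.
End differentiability.

(** * Symmetry of second derivatives *)

Section second_derivatives.
Set Implicit Arguments.
Unset Strict Implicit.
Context {R : realType}.
Implicit Types V W : normedModType R.

Lemma differentiable_line V (p u : V) (s : R) :
  differentiable (fun s : R => p + s *: u) s.
Proof.
apply: differentiable_addf; first exact: differentiable_cst.
exact: (@differentiableZl _ _ _ id).
Qed.

Lemma derive_line V (p u : V) (s : R) : 'D_1 (fun s : R => p + s *: u) s = u.
Proof.
have di : differentiable (id : R -> R) s by [].
have dsu : differentiable (fun s : R => s *: u) s.
  exact: (@differentiableZl _ _ _ id).
rewrite (@deriveD _ _ _ (cst p) (fun s : R => s *: u)); last 2 first.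
- exact: derivable_cst.
- exact: diff_derivable.
by rewrite derive_cst add0r (deriveE _ dsu) (diffZl _ di) -(deriveE _ di) derive_id
  scale1r.
Qed.

Lemma MVT_line V (f : V -> R) (p u : V) (r : R) : 0 < r ->
  (forall s, 0 <= s <= r -> differentiable f (p + s *: u)) ->
  exists2 s, 0 <= s <= r & f (p + r *: u) - f p = r * 'D_u f (p + s *: u).
Proof.
move=> r0 df; pose l (s : R) := p + s *: u.
have dfl s : 0 <= s <= r -> differentiable (f \o l) s.
  by move=> s0r; apply: differentiable_comp (differentiable_line _ _ _) (df _ s0r).
have [||s] := @MVT R (f \o l) (fun s => 'D_u f (l s)) 0 r r0.
- move=> s; rewrite in_itv/= => /andP[s0 sr].
  have s0r : 0 <= s <= r by rewrite !ltW.
  apply: DeriveDef; first exact/diff_derivable/dfl.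
  by rewrite (derive_comp _ (differentiable_line p u s) (df s s0r)) derive_line.
- apply: derivable_within_continuous => s; rewrite in_itv/= => s0r.
  exact/diff_derivable/dfl.
- rewrite in_itv/= => /andP[s0 sr]; rewrite subr0 mulrC /l/= scale0r addr0 => E.
  by exists s; rewrite ?ltW.
Qed.

(** The mean value theorem is used twice: along [u] for the increment of [f] over [r *: v], then
    along [v] for the derivative ['D_u f] so obtained. *)
Lemma second_difference V (f : V -> R) (x u v : V) (r : R) : 0 < r ->
  (forall s t, 0 <= s <= r -> 0 <= t <= r ->
     differentiable f (x + s *: u + t *: v) /\
     differentiable (fun y => 'D_u f y) (x + s *: u + t *: v)) ->
  exists s t, [/\ 0 <= s <= r, 0 <= t <= r &
    f (x + r *: u + r *: v) - f (x + r *: u) - (f (x + r *: v) - f x) =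
    r ^+ 2 * 'D_v (fun y => 'D_u f y) (x + s *: u + t *: v)].
Proof.
move=> r0 df.
have r0r : 0 <= r <= r by rewrite lexx ltW.
have z0r : 0 <= (0 : R) <= r by rewrite lexx ltW.
pose sh (y : V) := y + r *: v.
have dsh y : differentiable sh y.
  by apply: differentiable_addf => //; exact: differentiable_cst.
pose g y := f (y + r *: v) - f y.
have dfr s : 0 <= s <= r -> differentiable (f \o sh) (x + s *: u).
  by move=> s0r; apply: differentiable_comp => //; have [] := df s r s0r r0r.
have df0 s : 0 <= s <= r -> differentiable f (x + s *: u).
  by move=> s0r; have [+ _] := df s 0 s0r z0r; rewrite scale0r addr0.
have Dsh y : 'D_u sh y = u.
  rewrite (@deriveD _ _ _ id (cst (r *: v)))//.
  by rewrite derive_id derive_cst addr0.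
have [s|s s0r gE] := @MVT_line V g x u r r0.
  by move=> s0r; apply: (@differentiableB _ _ _ (f \o sh) f); [exact: dfr|exact: df0].
have [t|t t0r fE] := @MVT_line V (fun y => 'D_u f y) (x + s *: u) v r r0.
  by move=> t0r; have [] := df s t s0r t0r.
exists s, t; split=> //; rewrite expr2 -mulrA -fE.
rewrite -/(g (x + r *: u)) -/(g x) gE; congr (_ * _).
rewrite (@deriveB _ _ _ (f \o sh) f); last 2 first.
- exact/diff_derivable/dfr.
- exact/diff_derivable/df0.
rewrite derive_comp ?Dsh//.
by have [] := df s r s0r r0r.
Qed.

Lemma ler_dist_half (a b c e : R) :
  `|b - c| < e / 2 -> `|a - c| < e / 2 -> `|a - b| <= e.
Proof.
move=> bc ac; rewrite (le_trans (ler_distD c _ _))// (splitr e) ltW// ltrD//.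
by rewrite distrC.
Qed.

(** The second difference is symmetric in [u] and [v]. Divided by [r ^+ 2] it is a value of either
    mixed derivative at some point of a small parallelogram, and by continuity both values are
    within [e / 2] of those at [x]. *)
Lemma derive_comm V (f : V -> R) (U : set V) (x u v : V) :
  open U -> U x -> Ck_on 2 U f ->
  'D_u (fun y => 'D_v f y) x = 'D_v (fun y => 'D_u f y) x.
Proof.
move=> oU Ux [df /= d2f].
apply/eqP; rewrite -subr_eq0 -normr_le0; apply/ler_addgt0Pl => e e0.
rewrite addr0.
have [_ /(_ u) cvu] := d2f v; have [_ /(_ v) cuv] := d2f u.
pose close y := [/\ U y,
  `|'D_u (fun y => 'D_v f y) x - 'D_u (fun y => 'D_v f y) y| < e / 2 &
  `|'D_v (fun y => 'D_u f y) x - 'D_v (fun y => 'D_u f y) y| < e / 2].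
have nclose : \forall y \near x, close y.
  have e20 : 0 < e / 2 by rewrite divr_gt0.
  have := open_nbhs_nbhs (conj oU Ux).
  have /cvgrPdist_lt/(_ _ e20) := cvu x Ux.
  have /cvgrPdist_lt/(_ _ e20) := cuv x Ux.
  by apply: filterS3 => y cy1 cy2 Uy; exact: And3 Uy cy2 cy1.
have [d /= d0 dclose] : exists2 d : R, 0 < d &
    forall y, `|x - y| < d -> close y.
  have /nbhs_ballP[d /= d0 dP] := nclose; exists d => // y xy.
  by apply: dP; rewrite -ball_normE.
(* This size keeps the whole parallelogram within distance [d] of [x]; the summand 1 makes the
   denominator positive even when both directions vanish. *)
pose r := d / (`|u| + `|v| + 1).
have uv0 : 0 < `|u| + `|v| + 1 by rewrite ltr_wpDl// addr_ge0.
have r0 : 0 < r by rewrite divr_gt0.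
have box s t : 0 <= s <= r -> 0 <= t <= r -> close (x + s *: u + t *: v).
  move=> /andP[s0 sr] /andP[t0 tr]; apply: dclose.
  rewrite -addrA opprD addrA subrr add0r normrN.
  apply: le_lt_trans (ler_normD _ _) _; rewrite !normrZ !ger0_norm//.
  apply: (@le_lt_trans _ _ (r * (`|u| + `|v|))).
    by rewrite mulrDr lerD// ler_wpM2r.
  by rewrite /r mulrAC ltr_pdivrMr// ltr_pM2l// ltrDl.
have [s [t [s0r t0r E1]]] := @second_difference V f x u v r r0 (fun s t hs ht =>
  let: And3 Uy _ _ := box s t hs ht in conj (df _ Uy) ((d2f u).1 _ Uy)).
have box' a b : 0 <= a <= r -> 0 <= b <= r -> close (x + a *: v + b *: u).
  by move=> hs ht; rewrite addrAC; exact: box.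
have [s' [t' [s0r' t0r' E2]]] := @second_difference V f x v u r r0 (fun s t hs ht =>
  let: And3 Uy _ _ := box' s t hs ht in conj (df _ Uy) ((d2f v).1 _ Uy)).
have E : 'D_v (fun y => 'D_u f y) (x + s *: u + t *: v) =
         'D_u (fun y => 'D_v f y) (x + s' *: v + t' *: u).
  have r20 : r ^+ 2 != 0 by rewrite expf_neq0// gt_eqF.
  apply: (mulfI r20); rewrite -E1 -E2 (addrAC x (r *: v)).
  by ring.
have [_ _ c1] := box s t s0r t0r; have [_ c2 _] := box' s' t' s0r' t0r'.
rewrite E in c1; exact: ler_dist_half c1 c2.
Qed.

(** Since [U] is open, equality on [U] is equality near each of its points, so it passes to
    directional derivatives and the induction goes on. *)
Lemma eq_Ck_on V W k (U : set V) (f g : V -> W) : open U ->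
  (forall x, U x -> f x = g x) -> Ck_on k U f -> Ck_on k U g.
Proof.
move=> oU; elim: k f g => [|k IH] f g fg /=.
  move=> cf x Ux; have := cf x Ux; rewrite /prop_for/continuous_at (fg x Ux).
  apply: cvg_trans; apply: near_eq_cvg.
  by apply: filterS (open_nbhs_nbhs (conj oU Ux)) => y Uy; rewrite fg.
have nfg x : U x -> {near x, f =1 g}.
  by move=> Ux; apply: filterS (open_nbhs_nbhs (conj oU Ux)) => y Uy; rewrite fg.
move=> [df Df]; split=> [x Ux|v].
  by apply: near_eq_differentiable (df x Ux); exact: nfg.
apply: IH (Df v) => x Ux; apply: near_eq_derive.
exact: nfg.
Qed.

Lemma Ck_on_mxE V m n k (U : set V) (f : V -> 'M[R]_(m, n)) i j : open U ->
  Ck_on k U f -> Ck_on k U (fun x => f x i j).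
Proof.
move=> oU; elim: k f => [|k IH] f /=.
  move=> cf x Ux; apply: (@continuous_comp _ _ _ f (fun N => N i j)).
    exact: cf.
  exact: coord_continuous.
move=> [df Df]; split=> [x Ux|v]; first exact/differentiable_mxE/df.
apply: eq_Ck_on (IH _ (Df v)) => // x Ux.
by rewrite derive_mxE//; exact: df.
Qed.

End second_derivatives.

(** * Partial derivatives in jet coordinates *)

Section jet_derivatives.
Set Implicit Arguments.
Unset Strict Implicit.
Context {R : realType} {n : nat}.
Implicit Types (W : normedModType R) (w v : jcoords R n).

Lemma derive_pd (F : jcoords R n -> R) w (r : R) (u y : 'rV[R]_n) :
  differentiable F w ->
  'D_((r, u, y) : jcoords R n) F w =
  r * pd_t F w + \sum_i u 0 i * pd_x i F w + \sum_i y 0 i * pd_y i F w.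
Proof.
move=> dF.
have -> : ((r, u, y) : jcoords R n) =
    r *: ((1, 0, 0) : jcoords R n) +
    (\sum_i u 0 i *: ((0, delta_mx 0 i, 0) : jcoords R n) +
    \sum_i y 0 i *: ((0, 0, delta_mx 0 i) : jcoords R n)).
  have sumE I (s : seq I) (f : I -> jcoords R n) : \sum_(i <- s) f i =
      (\sum_(i <- s) (f i).1.1, \sum_(i <- s) (f i).1.2, \sum_(i <- s) (f i).2).
    elim: s => [|i s IH]; first by rewrite !big_nil.
    by rewrite !big_cons IH; case: (f i) => [[]].
  rewrite !sumE /=; congr (_, _, _) => /=.
  - rewrite [r *: 1]mulr1 !big1 ?addr0// => i _; exact: mulr0.
  - rewrite scaler0 add0r [X in _ + X]big1 ?addr0; last by move=> i _; exact: scaler0.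
    exact: row_sum_delta.
  - rewrite scaler0 add0r [X in X + _]big1 ?add0r; last by move=> i _; exact: scaler0.
    exact: row_sum_delta.
rewrite derive_linear// -addrA; congr (_ + _).
rewrite !(deriveE _ dF) linearD/= -!(deriveE _ dF) !derive_lincomb//.
Qed.

Lemma differentiable_tf W (g : R -> W) w : differentiable g w.1.1 ->
  differentiable (fun w : jcoords R n => g w.1.1) w.
Proof.
move=> dg; apply: (@differentiable_comp _ _ _ _ (fun w : jcoords R n => w.1.1) g) => //.
apply: (@differentiable_comp _ _ _ _ (@fst (R * 'rV[R]_n)%type 'rV[R]_n) fst);
  exact: differentiable_fst.
Qed.

Lemma derive_tf W (g : R -> W) w v : differentiable g w.1.1 ->
  'D_v (fun w : jcoords R n => g w.1.1) w = v.1.1 *: 'D_1 g w.1.1.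
Proof.
move=> dg; rewrite (@derive_comp _ _ _ _ (fun w : jcoords R n => w.1.1) g)//; last first.
  exact: (@differentiable_tf _ id).
rewrite (@derive_comp _ _ _ _ (@fst (R * 'rV[R]_n)%type 'rV[R]_n) fst);
  [|exact: differentiable_fst..].
rewrite !derive_fst -[in LHS](mulr1 v.1.1) !(deriveE _ dg).
by rewrite -[_ * 1]/(_ *: _) linearZ.
Qed.

Lemma differentiable_xf W (g : 'rV[R]_n -> W) w : differentiable g w.1.2 ->
  differentiable (fun w : jcoords R n => g w.1.2) w.
Proof.
move=> dg; apply: (@differentiable_comp _ _ _ _ (fun w : jcoords R n => w.1.2) g) => //.
apply: (@differentiable_comp _ _ _ _ (@fst (R * 'rV[R]_n)%type 'rV[R]_n) snd);
  [exact: differentiable_fst|exact: differentiable_snd].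
Qed.

Lemma derive_xf W (g : 'rV[R]_n -> W) w v : differentiable g w.1.2 ->
  'D_v (fun w : jcoords R n => g w.1.2) w = 'D_(v.1.2) g w.1.2.
Proof.
move=> dg; rewrite (@derive_comp _ _ _ _ (fun w : jcoords R n => w.1.2) g)//; last first.
  exact: (@differentiable_xf _ id).
rewrite (@derive_comp _ _ _ _ (@fst (R * 'rV[R]_n)%type 'rV[R]_n) snd);
  [|exact: differentiable_fst|exact: differentiable_snd].
by rewrite derive_fst derive_snd.
Qed.

Lemma differentiable_y w i :
  differentiable (fun w : jcoords R n => w.2 0 i) w.
Proof. exact/differentiable_mxE/differentiable_snd. Qed.

Lemma derive_y w v i : 'D_v (fun w : jcoords R n => w.2 0 i) w = v.2 0 i.
Proof.
by rewrite derive_mxE ?derive_snd//; exact: differentiable_snd.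
Qed.

End jet_derivatives.

(** * Change of jet coordinates *)

(* Transparent, [derive] makes failing unifications of distinct directional
   derivatives prohibitively slow. *)
Local Opaque derive.

Section coordinate_change.
Set Implicit Arguments.
Unset Strict Implicit.
Context {R : realType} {n : nat}.
Implicit Types (w v z : jcoords R n).

(** The bracket of the spray with the Hessian of [f] in place of [2 h^11 g]. The metric thus enters
    only through [H], which is never differentiated here and can be a mere number. *)
Definition spray_form (H : R) (f : jcoords R n -> R) w (k : 'I_n) : R :=
  \sum_(j < n) pd_x j (pd_y k f) w * w.2 0 j - pd_x k f w + pd_t (pd_y k f) w
  + pd_y k f w * H + H * \sum_(m < n) pd_y m (pd_y k f) w * w.2 0 m.

Lemma spray_formE (H : R) (f : jcoords R n -> R) w k : differentiable (pd_y k f) w ->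
  spray_form H f w k = 'D_((1, w.2, H *: w.2) : jcoords R n) (pd_y k f) w
               - pd_x k f w + H * pd_y k f w.
Proof.
move=> df; rewrite (derive_pd _ _ _ df) mul1r.
rewrite [X in _ = _ + X + _ - _ + _](eq_bigr (fun i => pd_x i (pd_y k f) w * w.2 0 i));
  last by move=> i _; rewrite mulrC.
rewrite [X in _ = _ + _ + X - _ + _](eq_bigr (fun i => H * (pd_y i (pd_y k f) w * w.2 0 i)));
  last by move=> i _; rewrite mxE -mulrA (mulrC (w.2 0 i)).
rewrite -mulr_sumr /spray_form.
have aux (A B C D E : R) : A - B + C + D * H + H * E = C + A + H * E - B + H * D.
  by ring.
exact: aux.
Qed.

Lemma derive_pd_fibre (f : jcoords R n -> R) w (u : 'rV[R]_n) :
  differentiable f w ->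
  'D_((0, 0, u) : jcoords R n) f w = \sum_i u 0 i * pd_y i f w.
Proof.
move=> df; rewrite (derive_pd _ _ _ df) mul0r add0r.
by rewrite [X in X + _]big1 ?add0r// => i _; rewrite mxE mul0r.
Qed.

Variables (th a : R -> R) (ph : 'rV[R]_n -> 'rV[R]_n) (J : 'rV[R]_n -> 'M[R]_n).

(** Here [th] and [ph] stand for the changes of time and position, [J] for the Jacobian of [ph], and
    [a] for dt/dt' as a function of the old time. *)
Definition jet_change w : jcoords R n :=
  (th w.1.1, ph w.1.2, \row_j \sum_(i < n) J w.1.2 i j * a w.1.1 * w.2 0 i).

(** Exactly the properties of a change of coordinates that the calculus at one point uses. [reg_K]
    serves to differentiate [hess_quad], which already contains first derivatives of [J]. *)
Record regular_at w : Prop := RegularAt {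
  reg_th : differentiable th w.1.1;
  reg_a : differentiable a w.1.1;
  reg_inv : a w.1.1 * 'D_1 th w.1.1 = 1;
  reg_ph : differentiable ph w.1.2;
  reg_J : forall i j, differentiable (fun x => J x i j) w.1.2;
  reg_K : forall i j k,
    differentiable (fun x => 'D_(delta_mx 0 k) (fun x => J x i j) x) w.1.2;
  reg_Dph : forall u, 'D_u ph w.1.2 = u *m J w.1.2;
  reg_sym : forall i k j, 'D_(delta_mx 0 k) (fun x => J x i j) w.1.2 =
                          'D_(delta_mx 0 i) (fun x => J x k j) w.1.2
}.

Section at_a_point.
Variables (w : jcoords R n).
Hypothesis rw : regular_at w.

Lemma differentiable_newy j :
  differentiable (fun w => \sum_(i < n) J w.1.2 i j * a w.1.1 * w.2 0 i) w.
Proof.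
apply: differentiable_sumf => i _; apply: differentiable_mulf.
  apply: differentiable_mulf; last exact: differentiable_tf (reg_a rw).
  exact: (differentiable_xf (g := fun x => J x i j) (reg_J rw i j)).
exact: differentiable_y.
Qed.

Lemma derive_newy v j :
  'D_v (fun w => \sum_(i < n) J w.1.2 i j * a w.1.1 * w.2 0 i) w =
  \sum_(i < n) (('D_(v.1.2) (fun x => J x i j) w.1.2 * a w.1.1
      + J w.1.2 i j * (v.1.1 * 'D_1 a w.1.1)) * w.2 0 i
      + J w.1.2 i j * a w.1.1 * v.2 0 i).
Proof.
have dJ i := differentiable_xf (g := fun x => J x i j) (reg_J rw i j).
have da := differentiable_tf (reg_a rw).
rewrite derive_sumf; last first.
  move=> i; apply: differentiable_mulf; last exact: differentiable_y.
  exact: differentiable_mulf.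
apply: eq_bigr => i _; rewrite derive_mulf; last 2 first.
- exact: differentiable_mulf.
- exact: differentiable_y.
rewrite derive_mulf// derive_y derive_tf; last exact: reg_a.
by rewrite (derive_xf (g := fun x => J x i j))//; exact: reg_J.
Qed.

Lemma differentiable_jet_change : differentiable jet_change w.
Proof.
apply: differentiable_pair.
  apply: differentiable_pair; first exact: differentiable_tf (reg_th rw).
  exact: differentiable_xf (reg_ph rw).
apply: differentiable_mx => i j; under eq_fun do rewrite mxE.
exact: differentiable_newy.
Qed.

Lemma derive_jet_change v : 'D_v jet_change w =
  (v.1.1 * 'D_1 th w.1.1, v.1.2 *m J w.1.2,
   \row_j \sum_(i < n) (('D_(v.1.2) (fun x => J x i j) w.1.2 * a w.1.1
      + J w.1.2 i j * (v.1.1 * 'D_1 a w.1.1)) * w.2 0 i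
      + J w.1.2 i j * a w.1.1 * v.2 0 i)).
Proof.
have dth := differentiable_tf (reg_th rw).
have dph := differentiable_xf (reg_ph rw).
have dy : differentiable (fun w : jcoords R n =>
    \row_j \sum_(i < n) J w.1.2 i j * a w.1.1 * w.2 0 i) w.
  by apply: differentiable_mx => i j; under eq_fun do rewrite mxE;
    exact: differentiable_newy.
rewrite derive_pair//; last exact: differentiable_pair.
rewrite derive_pair//; congr (_, _, _).
- by rewrite derive_tf//; exact: reg_th.
- by rewrite derive_xf ?(reg_Dph rw)//; exact: reg_ph.
- apply/rowP => j; rewrite -derive_mxE// mxE -derive_newy.
  by congr ('D_v _ w); apply/funext => x; rewrite mxE.
Qed.

End at_a_point.

Variables (U : set (jcoords R n)) (f F : jcoords R n -> R).
Hypothesis oU : open U.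
Hypothesis reg : forall w, U w -> regular_at w.
Hypothesis fE : forall w, U w -> f w = F (jet_change w).
Hypothesis dF : forall w, U w -> differentiable F (jet_change w).

Lemma near_jet_change w : U w -> \forall x \near w, f x = F (jet_change x).
Proof.
by move=> Uw; apply: filterS (open_nbhs_nbhs (conj oU Uw)) => x /fE.
Qed.

Lemma derive_change w v : U w -> 'D_v f w = 'D_('D_v jet_change w) F (jet_change w).
Proof.
move=> Uw; rewrite (near_eq_derive _ (near_jet_change Uw)).
by rewrite (derive_comp _ (differentiable_jet_change (reg Uw)) (dF Uw)).
Qed.

Lemma pd_y_change k w : U w ->
  pd_y k f w = \sum_m J w.1.2 k m * a w.1.1 * pd_y m F (jet_change w).
Proof.
move=> Uw; rewrite /pd_y (derive_change _ Uw) (derive_jet_change (reg Uw)).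
rewrite (derive_pd _ _ _ (dF Uw)) /= !mul0r mul0mx add0r.
rewrite [X in X + _]big1 ?add0r; last by move=> i _; rewrite mxE mul0r.
apply: eq_bigr => m _; congr (_ * _); rewrite mxE /=.
rewrite (bigD1 k)//= big1 ?addr0 => [|i ik].
  by rewrite derive0 !mul0r mulr0 addr0 mul0r add0r mxE !eqxx mulr1.
by rewrite derive0 !mul0r mulr0 addr0 mul0r add0r mxE (negPf ik) andbF mulr0.
Qed.

(** The second sum reflects that the new fibre coordinates depend on the old position; it is what
    must cancel in [spray_form_change]. *)
Lemma pd_x_change k w : U w ->
  pd_x k f w = \sum_m J w.1.2 k m * pd_x m F (jet_change w) +
   \sum_m a w.1.1 * (\sum_(i < n) w.2 0 i *
     'D_(delta_mx 0 k) (fun x => J x i m) w.1.2) * pd_y m F (jet_change w).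
Proof.
move=> Uw; rewrite /pd_x (derive_change _ Uw) (derive_jet_change (reg Uw)) /=.
rewrite (derive_pd _ _ _ (dF Uw)) !mul0r add0r; congr (_ + _).
  by apply: eq_bigr => m _; rewrite -rowE mxE.
apply: eq_bigr => m _; congr (_ * _); rewrite mxE mulr_sumr.
by apply: eq_bigr => i _; rewrite mxE; ring.
Qed.

Hypothesis dF2 : forall k w, U w -> differentiable (pd_y k F) (jet_change w).

Lemma differentiable_pd_y_change k w : U w -> differentiable (pd_y k f) w.
Proof.
move=> Uw; apply: (@near_eq_differentiable _ _ _
    (fun w => \sum_m J w.1.2 k m * a w.1.1 * pd_y m F (jet_change w))).
  by apply: filterS (open_nbhs_nbhs (conj oU Uw)) => x Ux; rewrite pd_y_change.
apply: differentiable_sumf => m _; apply: differentiable_mulf.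
  apply: differentiable_mulf; last exact: differentiable_tf (reg_a (reg Uw)).
  exact: (differentiable_xf (g := fun x => J x k m) (reg_J (reg Uw) k m)).
exact: differentiable_comp (differentiable_jet_change (reg Uw)) (dF2 m Uw).
Qed.

Lemma derive_pd_y_change k w v : U w -> 'D_v (pd_y k f) w =
  \sum_m (('D_(v.1.2) (fun x => J x k m) w.1.2 * a w.1.1
      + J w.1.2 k m * (v.1.1 * 'D_1 a w.1.1)) * pd_y m F (jet_change w) +
      J w.1.2 k m * a w.1.1 * 'D_('D_v jet_change w) (pd_y m F) (jet_change w)).
Proof.
move=> Uw.
have dJ m := differentiable_xf (g := fun x => J x k m) (reg_J (reg Uw) k m).
have da := differentiable_tf (reg_a (reg Uw)).
have dJa m := differentiable_mulf (dJ m) da.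
have dFm m := differentiable_comp (differentiable_jet_change (reg Uw)) (dF2 m Uw).
rewrite (@near_eq_derive _ _ _ _
    (fun w => \sum_m J w.1.2 k m * a w.1.1 * pd_y m F (jet_change w))); last first.
  by apply: filterS (open_nbhs_nbhs (conj oU Uw)) => x Ux; rewrite pd_y_change.
rewrite derive_sumf; last by move=> m; exact: differentiable_mulf (dJa m) (dFm m).
apply: eq_bigr => m _.
rewrite (derive_mulf _ (dJa m) (dFm m)) (derive_mulf _ (dJ m) da).
rewrite (derive_comp _ (differentiable_jet_change (reg Uw)) (dF2 m Uw)).
rewrite derive_tf; last exact: reg_a (reg Uw).
by rewrite (derive_xf (g := fun x => J x k m) _ (reg_J (reg Uw) k m)).
Qed.

(* [hess_quad w 0 p] is the second derivative in the direction [w.2] of the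
   component [p] of [ph]. *)
Definition hess_quad w : 'rV[R]_n :=
  \row_p \sum_i w.2 0 i * 'D_(w.2) (fun x => J x i p) w.1.2.

Lemma derive_spray_direction (H Ht : R) w : U w ->
  Ht = a w.1.1 * H + 'D_1 a w.1.1 ->
  'D_((1, w.2, H *: w.2) : jcoords R n) jet_change w =
  'D_1 th w.1.1 *: ((1, (jet_change w).2, Ht *: (jet_change w).2) : jcoords R n) +
  (0, 0, a w.1.1 *: hess_quad w).
Proof.
move=> Uw HtE; rewrite (derive_jet_change (reg Uw)) /=.
have ath := reg_inv (reg Uw).
(* The new fibre coordinate is [a] times [w.2 *m J], and dt'/dt is the inverse of [a]. *)
have yE : 'D_1 th w.1.1 *: (jet_change w).2 = w.2 *m J w.1.2.
  apply/rowP => j; rewrite !mxE mulr_sumr; apply: eq_bigr => i _.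
  have aux (b t Jk y : R) : b * t = 1 -> t * (Jk * b * y) = y * Jk.
    move=> bt; have -> : t * (Jk * b * y) = (b * t) * (y * Jk) by ring.
    by rewrite bt mul1r.
  exact: aux ath.
congr (_, _, _) => /=.
- by rewrite mul1r addr0 [RHS]mulr1.
- by rewrite addr0.
- rewrite [X in _ = X + _](_ : _ = Ht *: ('D_1 th w.1.1 *: (jet_change w).2)); last first.
    by rewrite !scalerA [Ht * _]mulrC.
  rewrite yE; apply/rowP => j; rewrite !mxE !mulr_sumr -big_split/=.
  apply: eq_bigr => i _; rewrite HtE mxE mul1r.
  have aux (X b b' Jk y : R) : (X * b + Jk * b') * y + Jk * b * (H * y) =
    (b * H + b') * (y * Jk) + b * (y * X) by ring.
  exact: aux.
Qed.

Lemma spray_form_change (H Ht : R) k w : U w ->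
  Ht = a w.1.1 * H + 'D_1 a w.1.1 ->
  spray_form H f w k = \sum_m J w.1.2 k m * (spray_form Ht F (jet_change w) m +
    a w.1.1 ^+ 2 * \sum_p hess_quad w 0 p * pd_y p (pd_y m F) (jet_change w)).
Proof.
move=> Uw HtE.
rewrite (spray_formE _ (differentiable_pd_y_change k Uw)).
rewrite (derive_pd_y_change _ _ Uw) (pd_y_change _ Uw) (pd_x_change _ Uw).
(* Second derivatives of [ph] enter twice: from [J] inside [pd_y k f], differentiated along [w.2],
   and from [pd_x_change]. Symmetry brings both to the same form, and they cancel in [aux]. *)
have sym m : \sum_i w.2 0 i * 'D_(delta_mx 0 k) (fun x => J x i m) w.1.2 =
    'D_(w.2) (fun x => J x k m) w.1.2.
  rewrite [in RHS](row_sum_delta w.2) derive_lincomb; last exact: (reg_J (reg Uw)).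
  by apply: eq_bigr => i _; rewrite (reg_sym (reg Uw)).
rewrite [X in _ - (_ + X) + _ = _](eq_bigr (fun m => a w.1.1 *
    'D_(w.2) (fun x => J x k m) w.1.2 * pd_y m F (jet_change w))); last first.
  by move=> m _; rewrite sym.
rewrite mulr_sumr -big_split/= -sumrB -big_split/=.
apply: eq_bigr => m _.
rewrite (spray_formE _ (dF2 m Uw)) (derive_spray_direction Uw HtE).
rewrite (derive_linear _ _ _ (dF2 m Uw)) (derive_pd_fibre _ (dF2 m Uw)) /=.
rewrite [X in _ + _ * (_ + X) - _ + _ = _](eq_bigr (fun p => a w.1.1 *
    (hess_quad w 0 p * pd_y p (pd_y m F) (jet_change w)))); last first.
  by move=> p _; rewrite mxE mulrA.
rewrite -mulr_sumr.
have aux (X b b' Jk t D S P Q : R) : b * t = 1 ->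
    (X * b + Jk * (1 * b')) * P + Jk * b * (t * D + b * S)
    - (Jk * Q + b * X * P) + H * (Jk * b * P) =
    Jk * (D - Q + (b * H + b') * P + b ^+ 2 * S).
  move=> bt; have -> : Jk * b * (t * D + b * S) = Jk * ((b * t) * D + b ^+ 2 * S).
    by ring.
  by rewrite bt; ring.
by rewrite HtE; exact: aux (reg_inv (reg Uw)).
Qed.

End coordinate_change.

(** * Transformation of the spray and of its fibre derivatives *)

Section spray_change.
Set Implicit Arguments.
Unset Strict Implicit.
Context {R : realType} {n : nat}.
Implicit Types (w z : jcoords R n).

(** The metric data are frozen at their values at the point, because the law of the spray needs
    derivatives of the Lagrangian only. *)
Definition semispray (h H : R) (g : 'M[R]_n) (f : jcoords R n -> R) w : 'rV[R]_n :=
  \row_i \sum_k h * invmx g i k / 4 * spray_form H f w k.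

(** Symmetry of [g] lets its inverse act on row vectors from the right, so that the change of
    coordinates becomes a matrix identity. *)
Lemma semisprayE h H g f w : g^T = g ->
  semispray h H g f w = (h / 4) *: ((\row_k spray_form H f w k) *m invmx g).
Proof.
move=> gT; apply/rowP => i; rewrite !mxE mulr_sumr; apply: eq_bigr => k _.
rewrite mxE -[in RHS]gT -trmx_inv mxE.
have aux (x y t : R) : x * y / 4 * t = x / 4 * (t * y) by field.
exact: aux.
Qed.

Lemma congr_invmx (P g g' : 'M[R]_n) : P \in unitmx -> g \in unitmx ->
  g = P *m g' *m P^T -> P^T *m invmx g *m P = invmx g'.
Proof.
move=> uP ug gE.
have inv1 : (P^T *m invmx g *m P) *m g' = 1%:M.
  have uPT : P^T \in unitmx by rewrite unitmx_tr.
  (* Inserting [P^T] times its inverse on the right completes [P *m g'] to [g], which cancels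
     [invmx g]. *)
  rewrite -[LHS]mulmx1 -(mulmxV uPT) !mulmxA -(mulmxA _ P) -(mulmxA _ _ (P^T)) -gE.
  by rewrite -(mulmxA _ _ g) mulVmx// mulmx1 mulmxV.
have [_ ug'] := mulmx1_unit inv1.
by rewrite -[LHS]mulmx1 -(mulmxV ug') mulmxA inv1 mul1mx.
Qed.

Variables (th a : R -> R) (ph : 'rV[R]_n -> 'rV[R]_n) (J : 'rV[R]_n -> 'M[R]_n).
Variables (U : set (jcoords R n)).
Hypothesis oU : open U.
Hypothesis reg : forall w, U w -> regular_at th a ph J w.

Lemma semispray_change (f F : jcoords R n -> R) (h ht H Ht : R) (g gt : 'M[R]_n) w :
  (forall w, U w -> f w = F (jet_change th a ph J w)) ->
  (forall w, U w -> differentiable F (jet_change th a ph J w)) ->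
  (forall k w, U w -> differentiable (pd_y k F) (jet_change th a ph J w)) ->
  U w -> h != 0 -> ht = h * a w.1.1 ^+ 2 -> Ht = a w.1.1 * H + 'D_1 a w.1.1 ->
  J w.1.2 \in unitmx -> g \in unitmx -> g = J w.1.2 *m gt *m (J w.1.2)^T ->
  g^T = g -> gt^T = gt ->
  (forall p m, pd_y p (pd_y m F) (jet_change th a ph J w) = 2 * ht^-1 * gt p m) ->
  semispray ht Ht gt F (jet_change th a ph J w) =
  a w.1.1 ^+ 2 *: (semispray h H g f w *m J w.1.2 - 2^-1 *: hess_quad J w).
Proof.
move=> fE dF dF2 Uw h0 htE HtE uJ ug gE gT gtT hess.
have a0 : a w.1.1 != 0.
  by apply/eqP => a0; have := reg_inv (reg Uw); rewrite a0 mul0r => /esym/eqP;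
    rewrite oner_eq0.
have ugt : gt \in unitmx.
  by move: ug; rewrite gE !unitmx_mul => /andP[/andP[_ ->]].
(* The Hessian of [F] being [2 / ht] times [gt], the quadratic term becomes [hess_quad J w *m gt],
   ready to be cancelled by [invmx gt]. *)
have eE : \row_k spray_form H f w k =
    (\row_k spray_form Ht F (jet_change th a ph J w) k +
     (a w.1.1 ^+ 2 * (2 * ht^-1)) *: (hess_quad J w *m gt)) *m (J w.1.2)^T.
  apply/rowP => k; rewrite !mxE (spray_form_change oU reg fE dF dF2 k Uw HtE).
  apply: eq_bigr => m _; rewrite !mxE mulrC; congr ((_ + _) * _).
  rewrite -mulrA; congr (_ * _); rewrite mulr_sumr; apply: eq_bigr => p _.
  by rewrite hess mulrCA.
rewrite !semisprayE// eE -scalemxAl -mulmxA -mulmxA (mulmxA (J w.1.2)^T).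
rewrite (congr_invmx uJ ug gE) mulmxDl -scalemxAl -mulmxA mulmxV// mulmx1.
rewrite scalerDr scalerA scalerN scalerDr !scalerA -addrA -scalerBl.
have -> : a w.1.1 ^+ 2 * (h / 4) * (a w.1.1 ^+ 2 * (2 / ht)) -
    a w.1.1 ^+ 2 / 2 = 0 by rewrite htE; field; rewrite a0 h0.
by rewrite scale0r addr0; congr (_ *: _); rewrite htE; field.
Qed.

Lemma connection_change (G Gt : jcoords R n -> 'rV[R]_n) z i j : U z ->
  (forall w, U w -> Gt (jet_change th a ph J w) =
     a w.1.1 ^+ 2 *: (G w *m J w.1.2 - 2^-1 *: hess_quad J w)) ->
  (forall k, differentiable (fun w => G w 0 k) z) ->
  (forall w, U w -> differentiable (fun w => Gt w 0 j) (jet_change th a ph J w)) ->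
  \sum_(k < n) pd_y k (fun w => Gt w 0 j) (jet_change th a ph J z) * J z.1.2 i k =
  \sum_(k < n) pd_y i (fun w => G w 0 k) z * a z.1.1 * J z.1.2 k j
  - pd_x i (fun w => (jet_change th a ph J w).2 0 j) z.
Proof.
move=> Uz GtE dG dGt.
(* In [hess_quad] the direction of differentiation is itself [w.2]. Expanding it in the basis makes
   the dependence on the fibre an explicit quadratic polynomial, to which the product rule
   applies. *)
pose f w := a w.1.1 ^+ 2 * (\sum_k G w 0 k * J w.1.2 k j - 2^-1 *
  \sum_k \sum_l w.2 0 k * (w.2 0 l * 'D_(delta_mx 0 l) (fun x => J x k j) w.1.2)).
have fE w : U w -> f w = Gt (jet_change th a ph J w) 0 j.
  move=> Uw; rewrite GtE// !mxE; congr (_ * (_ - _ * _)); apply: eq_bigr => k _.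
  rewrite -mulr_sumr; congr (_ * _).
  rewrite [in RHS](row_sum_delta w.2) derive_lincomb//; exact: (reg_J (reg Uw)).
have a0 : a z.1.1 != 0.
  by apply/eqP => a0; have := reg_inv (reg Uz); rewrite a0 mul0r => /esym/eqP;
    rewrite oner_eq0.
have pdf := pd_y_change oU reg fE dGt i Uz.
have dJ k := differentiable_xf (g := fun x => J x k j) (reg_J (reg Uz) k j).
have dK k l := differentiable_xf (g := fun x => 'D_(delta_mx 0 l) (fun x => J x k j) x)
  (reg_K (reg Uz) k j l).
have dy k := @differentiable_y R n z k.
have da2 : differentiable (fun w : jcoords R n => a w.1.1 ^+ 2) z.
  by apply: differentiable_mulf; exact: differentiable_tf (reg_a (reg Uz)).
have dGJ k := differentiable_mulf (dG k) (dJ k).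
have dyK k l := differentiable_mulf (dy l) (dK k l).
have dyyK k l := differentiable_mulf (dy k) (dyK k l).
have dS1 := differentiable_sumf (index_enum 'I_n) (P := xpredT) (fun k _ => dGJ k).
have dS3 k := differentiable_sumf (index_enum 'I_n) (P := xpredT) (fun l _ => dyyK k l).
have dS2 := differentiable_sumf (index_enum 'I_n) (P := xpredT) (fun k _ => dS3 k).
have Df : pd_y i f z = a z.1.1 ^+ 2 * (\sum_k pd_y i (fun w => G w 0 k) z * J z.1.2 k j
   - \sum_k z.2 0 k * 'D_(delta_mx 0 i) (fun x => J x k j) z.1.2).
  have dhS2 := differentiable_mulf (differentiable_cst (2^-1 : R) z) dS2.
  have dS12 := differentiable_addf dS1 (differentiable_oppf dhS2).
  rewrite {1}/pd_y (derive_mulf _ da2 dS12).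
  rewrite (derive_tf (g := fun t => a t ^+ 2)); last first.
    exact: (differentiable_mulf (reg_a (reg Uz)) (reg_a (reg Uz))).
  rewrite /= scale0r mul0r add0r; congr (_ * _).
  rewrite (deriveB (diff_derivable dS1) (diff_derivable dhS2)).
  rewrite (derive_mulf _ (differentiable_cst (2^-1 : R) z) dS2) derive_cst mul0r add0r.
  rewrite (derive_sumf _ dGJ) (derive_sumf _ dS3).
  congr (_ - _).
    apply: eq_bigr => k _; rewrite (derive_mulf _ (dG k) (dJ k)).
    rewrite (derive_xf (g := fun x => J x k j) _ (reg_J (reg Uz) k j)) /=.
    by rewrite derive0 mulr0 addr0.
  have DyyK k l : 'D_((0, 0, delta_mx 0 i) : jcoords R n) (fun w : jcoords R n =>
      w.2 0 k * (w.2 0 l * 'D_(delta_mx 0 l) (fun x => J x k j) w.1.2)) z =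
      (i == k)%:R * (z.2 0 l * 'D_(delta_mx 0 l) (fun x => J x k j) z.1.2) +
      (i == l)%:R * (z.2 0 k * 'D_(delta_mx 0 l) (fun x => J x k j) z.1.2).
    rewrite (derive_mulf _ (dy k) (dyK k l)) (derive_mulf _ (dy l) (dK k l)).
    rewrite !derive_y (derive_xf (g := fun x => 'D_(delta_mx 0 l) (fun x => J x k j) x) _
      (reg_K (reg Uz) k j l)) /= derive0 mulr0 addr0 !mxE !eqxx /=.
    rewrite !(eq_sym i); congr (_ + _); exact: mulrCA.
  have DS3 k : _ = _ := derive_sumf (0, 0, delta_mx 0 i) (dyyK k).
  rewrite (eq_bigr _ (fun k _ => etrans (DS3 k) (eq_bigr _ (fun l _ => DyyK k l)))).
  rewrite (eq_bigr _ (fun k _ => big_split _ _ _ _ _)) /=.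
  rewrite big_split /=.
  (* Only [k = i] survives in the first sum and only [l = i] in the second. By [reg_sym] the two
     results agree, which uses up the factor 1/2. *)
  rewrite [X in 2^-1 * (X + _)](bigD1 i)//= [X in 2^-1 * (_ + X + _)]big1 ?addr0; last first.
    move=> k ki; rewrite big1// => l _; by rewrite eq_sym (negPf ki) mul0r.
  under eq_bigr => l _ do rewrite eqxx mul1r (reg_sym (reg Uz)).
  rewrite [X in 2^-1 * (_ + X)](eq_bigr (fun k =>
      z.2 0 k * 'D_(delta_mx 0 i) (fun x => J x k j) z.1.2)); last first.
    move=> k _; rewrite (bigD1 i)//= eqxx mul1r big1 ?addr0// => l li.
    by rewrite eq_sym (negPf li) mul0r.
  have aux (x : R) : 2^-1 * (x + x) = x by field.
  exact: aux.
have Dx : pd_x i (fun w => (jet_change th a ph J w).2 0 j) z =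
    a z.1.1 * \sum_k z.2 0 k * 'D_(delta_mx 0 i) (fun x => J x k j) z.1.2.
  rewrite /pd_x; under eq_fun do rewrite mxE.
  rewrite (derive_newy (reg Uz)) mulr_sumr; apply: eq_bigr => k _ /=.
  rewrite mxE mul0r !mulr0 !addr0.
  have aux (x b y : R) : x * b * y = b * (y * x) by ring.
  exact: aux.
(* The chain rule for [f] produces the left side of the goal with an extra factor [a], while [Df]
   carries [a ^+ 2]; the goal is therefore compared after multiplication by [a]. *)
apply: (mulfI a0); rewrite Dx mulrBr mulrA -expr2.
rewrite [X in _ = X - _](_ : _ = a z.1.1 ^+ 2 *
    \sum_k pd_y i (fun w => G w 0 k) z * J z.1.2 k j); last first.
  rewrite !mulr_sumr; apply: eq_bigr => k _.
  have aux (x b y : R) : b * (x * b * y) = b ^+ 2 * (x * y) by ring.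
  exact: aux.
rewrite -mulrBr -Df pdf mulr_sumr; apply: eq_bigr => k _.
have aux (x b y : R) : b * (x * y) = y * b * x by ring.
exact: aux.
Qed.
End spray_change.

(** * Transition maps *)

Section charts.
Set Implicit Arguments.
Unset Strict Implicit.

Section smooth.
Context {R : realType}.
Implicit Types V W : normedModType R.

Lemma smooth_differentiable V W (U : set V) (f : V -> W) x :
  smooth_on U f -> U x -> differentiable f x.
Proof. by move=> /(_ 1%N)[+ _]; exact. Qed.

Lemma smooth_derive V W (U : set V) (f : V -> W) v :
  smooth_on U f -> smooth_on U (fun x => 'D_v f x).
Proof. by move=> sf k; have [_] := sf k.+1; exact. Qed.

Lemma derive_R1 W (f : R -> W) (x r : R) :
  differentiable f x -> 'D_r f x = r *: 'D_1 f x.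
Proof.
move=> df; rewrite !(deriveE _ df) -linearZ; congr ('d f x _).
by rewrite /GRing.scale/= mulr1.
Qed.

End smooth.

Section transition.
Context {R : realType} {V : normedModType R} {M : topologicalType}.
Implicit Types c : chart V M.

(** Written as the part of [cran c] that [cinv c] sends into [cdom c'], the overlap is open by
    continuity of [cinv c]. *)
Lemma overlapE c c' :
  overlap c c' = [set x | cran c x /\ cdom c' (cinv c x)].
Proof.
apply/seteqP; split=> [_ [p [cp c'p] <-]|x [[p cp <-]]] /=.
  by rewrite cmapK//; split => //; exists p.
by rewrite cmapK// => c'p; exists p.
Qed.

Lemma open_overlap c c' : open (overlap c c').
Proof.
rewrite overlapE openE => x [rx c'x].
have nr : nbhs x (cran c) by apply: open_nbhs_nbhs; split => //; exact: open_cran.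
have nd : nbhs x (fun y => cdom c' (cinv c y)).
  apply: (cinv_continuous rx); apply: open_nbhs_nbhs.
  by split => //; exact: open_cdom.
by apply: filterS2 nr nd.
Qed.

Lemma trans_overlap c c' x : overlap c c' x -> overlap c' c (trans c c' x).
Proof. by move=> [p [cp c'p] <-]; rewrite /trans cmapK//; exists p. Qed.

Lemma cinv_trans c c' x : overlap c c' x -> cinv c' (trans c c' x) = cinv c x.
Proof. by move=> [p [cp c'p] <-]; rewrite /trans !cmapK. Qed.

Lemma cinvK c c' x : overlap c c' x -> c (cinv c x) = x.
Proof. by move=> [p [cp c'p] <-]; rewrite cmapK. Qed.

Lemma overlap_ran c c' : overlap c c' `<=` cran c.
Proof. by move=> x; rewrite overlapE => -[]. Qed.

Lemma overlap_dom c c' x : overlap c c' x -> cdom c (cinv c x) /\ cdom c' (cinv c x).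
Proof. by move=> [p [cp c'p] <-]; rewrite cmapK. Qed.

Lemma trans_trans c c' c'' x : overlap c c' x ->
  trans c' c'' (trans c c' x) = trans c c'' x.
Proof. by move=> xc; rewrite {1}/trans cinv_trans. Qed.

Lemma near_overlap c c' x : overlap c c' x -> \forall y \near x, overlap c c' y.
Proof. by move=> xc; apply: open_nbhs_nbhs; split => //; exact: open_overlap. Qed.

Lemma near_trans_trans c c' c'' x : overlap c c' x ->
  \forall y \near x, (trans c' c'' \o trans c c') y = trans c c'' y.
Proof.
by move=> xc; apply: filterS (near_overlap xc) => y yc; exact: trans_trans.
Qed.

End transition.

(** * Jacobians of changes of position coordinates *)

Section space_transition.
Context {R : realType} {n : nat} {M : topologicalType}.
Implicit Types c : chart 'rV[R]_n M.

Lemma derive_trans c c' x u : differentiable (trans c c') x ->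
  'D_u (trans c c') x = u *m jac c c' x.
Proof. by move=> dx; rewrite deriveEjacobian. Qed.

Lemma jac_comp c c' c'' x : overlap c c' x ->
  differentiable (trans c c') x -> differentiable (trans c' c'') (trans c c' x) ->
  jac c c' x *m jac c' c'' (trans c c' x) = jac c c'' x.
Proof.
move=> xc d1 d2; have nE := near_trans_trans c'' xc.
have d3 : differentiable (trans c c'') x.
  by apply: near_eq_differentiable nE (differentiable_comp d1 d2).
apply/row_matrixP => i; rewrite !rowE mulmxA.
have E1 u := derive_trans u d1; have E2 u := derive_trans u d2.
rewrite -[X in X *m _ = _]E1 -[LHS]E2 -[RHS](derive_trans _ d3).
by rewrite -(near_eq_derive _ nE) (derive_comp _ d1 d2).
Qed.

Lemma jac_id c x : cran c x -> jac c c x = 1%:M.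
Proof.
move=> [p cp <-].
have ov : overlap c c (c p) by exists p.
have nid : {near c p, id =1 trans c c}.
  by apply: filterS (near_overlap ov) => y /cinvK.
have di : differentiable (trans c c) (c p).
  by apply: near_eq_differentiable nid _.
apply/row_matrixP => i; rewrite !rowE -(derive_trans _ di) -(near_eq_derive _ nid).
by rewrite derive_id mulmx1.
Qed.

Lemma jac_entry c c' x i j : differentiable (trans c c') x ->
  jac c c' x i j = 'D_(delta_mx 0 i) (fun x => trans c c' x 0 j) x.
Proof. by move=> d; rewrite (derive_mxE _ _ _ d) (derive_trans _ d) -rowE [RHS]mxE. Qed.

(** An entry of [jac] is a partial derivative of [trans] where the latter is differentiable, hence
    on the open overlap, and [eq_Ck_on] transfers smoothness from there. *)
Lemma smooth_jac c c' i j : smooth_on (overlap c c') (trans c c') ->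
  smooth_on (overlap c c') (fun x => jac c c' x i j).
Proof.
move=> st k.
have st0j : smooth_on (overlap c c') (fun x => trans c c' x 0 j).
  by move=> l; apply: Ck_on_mxE => //; exact: open_overlap.
apply: eq_Ck_on (smooth_derive (delta_mx 0 i) st0j k) => [|x xc].
  exact: open_overlap.
by rewrite -jac_entry//; exact: smooth_differentiable st xc.
Qed.

Lemma derive_jac_sym c c' i k j x : smooth_on (overlap c c') (trans c c') ->
  overlap c c' x ->
  'D_(delta_mx 0 k) (fun x => jac c c' x i j) x =
  'D_(delta_mx 0 i) (fun x => jac c c' x k j) x.
Proof.
move=> st xc.
have nE l : \forall y \near x, jac c c' y l j =
    'D_(delta_mx 0 l) (fun x => trans c c' x 0 j) y.
  apply: filterS (near_overlap xc) => y yc; apply: jac_entry.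
  exact: smooth_differentiable st yc.
rewrite (near_eq_derive _ (nE i)) (near_eq_derive _ (nE k)).
apply: (derive_comm (U := overlap c c')) => //; first exact: open_overlap.
by apply: Ck_on_mxE => //; exact: open_overlap.
Qed.

End space_transition.

(** * Changes of time and the Christoffel symbol *)

Section time_transition.
Context {R : realType}.
Implicit Types tau : time_chart R.

(** A time chart and its inverse are smooth with respect to the standard coordinate of the line,
    through which the transition map factors. *)
Lemma differentiable_time_trans tau tau' s : time_coord tau -> time_coord tau' ->
  overlap tau tau' s -> differentiable (trans tau tau') s.
Proof.
move=> [_ si] [st' _] os; have [_ d's] := overlap_dom os.
apply: (@differentiable_comp _ _ _ _ (cinv tau) tau').
  exact: smooth_differentiable si (overlap_ran os).
exact: smooth_differentiable st' d's.
Qed.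

Lemma differentiable_dtrans tau tau' s : time_coord tau -> time_coord tau' ->
  overlap tau tau' s -> differentiable (dtrans tau tau') s.
Proof.
move=> [_ si] [st' _] os; have [_ d's] := overlap_dom os.
have disi y : overlap tau tau' y -> differentiable (cinv tau) y.
  by move=> oy; exact: smooth_differentiable si (overlap_ran oy).
have dst y : overlap tau tau' y -> differentiable tau' (cinv tau y).
  by move=> /overlap_dom[_ oy]; exact: smooth_differentiable st' oy.
(* The chain rule writes [dtrans] near [s] as a product of first derivatives of smooth maps, so
   smoothness of composites does not have to be established. *)
apply: (@near_eq_differentiable _ _ _
    (fun s => 'D_1 (cinv tau) s * 'D_1 tau' (cinv tau s))).
  apply: filterS (near_overlap os) => y oy.
  rewrite /dtrans derive1E (derive_comp _ (disi y oy) (dst y oy)).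
  by rewrite [RHS](derive_R1 _ (dst y oy)).
apply: differentiable_mulf.
  have sdi := smooth_derive (1 : R) si.
  exact: (smooth_differentiable sdi (overlap_ran os)).
apply: (@differentiable_comp _ _ _ _ (cinv tau) (fun t => 'D_1 tau' t)).
  exact: disi.
have sdt := smooth_derive (1 : R) st'.
exact: (smooth_differentiable sdt d's).
Qed.

Lemma dtransK tau tau' s : time_coord tau -> time_coord tau' ->
  overlap tau tau' s ->
  dtrans tau' tau (trans tau tau' s) * 'D_1 (trans tau tau') s = 1.
Proof.
move=> tt tt' os.
have d1 := differentiable_time_trans tt tt' os.
have d2 := differentiable_time_trans tt' tt (trans_overlap os).
have nid : {near s, trans tau' tau \o trans tau tau' =1 id}.
  apply: filterS (near_overlap os) => y oy /=.
  by rewrite trans_trans// /trans (cinvK oy).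
have := near_eq_derive (1 : R) nid; rewrite derive_id (derive_comp _ d1 d2) (derive_R1 _ d2).
by rewrite /dtrans derive1E mulrC.
Qed.

(** This reconciles the factors [derive1 tau] and [derive1 tau'] by which [jpoint] normalizes
    velocities. *)
Lemma derive1_time tau tau' t : time_coord tau -> time_coord tau' ->
  cdom tau t -> cdom tau' t ->
  derive1 tau' t * dtrans tau' tau (tau' t) = derive1 tau t.
Proof.
move=> tt tt' dt dt'.
have os : overlap tau' tau (tau' t) by exists t.
have d1 : differentiable tau' t by exact: smooth_differentiable tt'.1 dt'.
have d2 := differentiable_time_trans tt' tt os.
have nE : {near t, trans tau' tau \o tau' =1 tau}.
  have : \forall y \near t, cdom tau' y.
    by apply: open_nbhs_nbhs; split => //; exact: open_cdom.
  by apply: filterS => y dy; rewrite /= /trans cmapK.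
rewrite /dtrans !derive1E -(near_eq_derive (1 : R) nE) (derive_comp _ d1 d2).
by rewrite [RHS](derive_R1 _ d2).
Qed.

(** Differentiating h' = h a^2 in the old time gives (dt'/dt) dh'/dt' = a^2 dh/dt + 2 h a da/dt.
    Multiplication by a / (2 h a^2), with a dt'/dt = 1, yields the law. *)
Lemma christoffel_trans (h : time_chart R -> R -> R) tau tau' s :
  semi_riemannian_metric h -> time_coord tau -> time_coord tau' ->
  overlap tau tau' s ->
  let a s := dtrans tau' tau (trans tau tau' s) in
  christoffel h tau' (trans tau tau' s) =
  a s * christoffel h tau s + 'D_1 a s.
Proof.
move=> [hs ht] tt tt' os a.
have os' := trans_overlap os.
have d1 := differentiable_time_trans tt tt' os.
have da : differentiable a s.
  exact: differentiable_comp d1 (differentiable_dtrans tt' tt os').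
have [sh h0] := hs _ tt; have [sh' h0'] := hs _ tt'.
have dh : differentiable (h tau) s by exact: smooth_differentiable sh (overlap_ran os).
have dh' : differentiable (h tau') (trans tau tau' s).
  exact: smooth_differentiable sh' (overlap_ran os').
have nE : \forall y \near s, (h tau' \o trans tau tau') y = h tau y * (a y * a y).
  by apply: filterS (near_overlap os) => y oy /=; rewrite ht// expr2.
have := near_eq_derive (1 : R) nE.
rewrite (derive_comp _ d1 dh') (derive_R1 _ dh') (derive_mulf _ dh (differentiable_mulf da da)).
rewrite (derive_mulf _ da da) -!derive1E => E.
have := dtransK tt tt' os; rewrite -/(a s) -derive1E => ath.
have hs0 := h0 _ (overlap_ran os).
have a0 : a s != 0 by apply/eqP => a0; move/eqP: ath; rewrite a0 mul0r eq_sym oner_eq0.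
rewrite /christoffel ht//= -/(a s).
have -> : derive1 (h tau') (trans tau tau' s) =
    a s * (derive1 (trans tau tau') s *: derive1 (h tau') (trans tau tau' s)).
  by rewrite -[_ *: _]/(_ * _) mulrA ath mul1r.
rewrite E.
have aux (x b b' y : R) : x != 0 -> b != 0 ->
  (x * b ^+ 2)^-1 / 2 * (b * (y * (b * b) + x * (b' * b + b * b'))) =
  b * (x^-1 / 2 * y) + b' by move=> x0 b0; field; rewrite x0 b0.
exact: aux.
Qed.

End time_transition.
End charts.

(** * Lagrangians on the jet space *)

Section jets.
Set Implicit Arguments.
Unset Strict Implicit.
Context {R : realType} {n : nat} {M : smooth_manifold R n}.
Implicit Types (tau : time_chart R) (c : chart 'rV[R]_n M).

Lemma smooth_trans c c' : atlas c -> atlas c' -> smooth_on (overlap c c') (trans c c').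
Proof. by move=> ac ac'; have [] := atlas_compatible ac ac'. Qed.

Lemma jac_mul c c' x : atlas c -> atlas c' -> overlap c c' x ->
  jac c c' x *m jac c' c (trans c c' x) = 1%:M.
Proof.
move=> ac ac' xc; rewrite jac_comp//.
- by rewrite jac_id//; exact: overlap_ran xc.
- exact: smooth_differentiable (smooth_trans ac ac') xc.
- exact: smooth_differentiable (smooth_trans ac' ac) (trans_overlap xc).
Qed.

Lemma open_box (A : set R) (B : set 'rV[R]_n) : open A -> open B ->
  open [set z : jcoords R n | A z.1.1 /\ B z.1.2].
Proof.
move=> oA oB; rewrite openE => z [Az Bz].
have n1 : nbhs z (fun z : jcoords R n => A z.1.1).
  apply: (differentiable_continuous (differentiable_tf (g := id) _)) => //.
  exact: open_nbhs_nbhs.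
have n2 : nbhs z (fun z : jcoords R n => B z.1.2).
  apply: (differentiable_continuous (differentiable_xf (g := id) _)) => //.
  exact: open_nbhs_nbhs.
exact: filterS2 n1 n2.
Qed.

Lemma open_jran tau c : open (jran tau c).
Proof. by apply: open_box; exact: open_cran. Qed.

Lemma open_joverlap tau c tau' c' : open (joverlap tau c tau' c').
Proof. by apply: open_box; exact: open_overlap. Qed.

Lemma joverlap_ran tau c tau' c' z : joverlap tau c tau' c' z -> jran tau c z.
Proof. by move=> [/overlap_ran ? /overlap_ran ?]. Qed.

Lemma jtrans_overlap tau c tau' c' z :
  joverlap tau c tau' c' z -> joverlap tau' c' tau c (jtrans tau c tau' c' z).
Proof. by move=> [zt zx]; split; exact: trans_overlap. Qed.

Lemma jtrans_ran tau c tau' c' z :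
  joverlap tau c tau' c' z -> jran tau' c' (jtrans tau c tau' c' z).
Proof. by move/jtrans_overlap/joverlap_ran. Qed.

Lemma new_yE tau c tau' c' (z : jcoords R n) : new_y tau c tau' c' z =
  dtrans tau' tau (trans tau tau' z.1.1) *: (z.2 *m jac c c' z.1.2).
Proof.
apply/rowP => j; rewrite !mxE mulr_sumr; apply: eq_bigr => i _.
by rewrite [jac _ _ _ _ _ * _]mulrC mulrAC -mulrA.
Qed.

(** Both sides have the same time and base point, hence the same preferred chart [C]. Their
    components in [C] agree by the chain rule for Jacobians from [c] through [c'] to [C], and by
    [derive1_time] for the time factor. *)
Lemma jpoint_jtrans tau c tau' c' z :
  time_coord tau -> atlas c -> time_coord tau' -> atlas c' ->
  joverlap tau c tau' c' z ->
  jpoint tau' c' (jtrans tau c tau' c' z) = jpoint tau c z.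
Proof.
move=> tt ac tt' ac' [zt zx]; rewrite /jpoint /=.
rewrite (cinv_trans zt) (cinv_trans zx).
apply: (congr1 (fun y => (cinv tau z.1.1, @Tangent R n M (cinv c z.1.2) y))).
have [dt dt'] := overlap_dom zt; have [dx dx'] := overlap_dom zx.
set p := cinv c z.1.2; set C := chart_at p.
have [aC Cp] : atlas C /\ cdom C p by exact: projT2 (cid (atlas_cover p)).
have ox : overlap c' C (trans c c' z.1.2).
  by rewrite overlapE /= (cinv_trans zx); split => //; exact: overlap_ran (trans_overlap zx).
rewrite -(jac_comp (c'' := C) zx (smooth_differentiable (smooth_trans ac ac') zx)
  (smooth_differentiable (smooth_trans ac' aC) ox)).
rewrite new_yE -scalemxAl scalerA mulmxA; congr (_ *: _).
exact: derive1_time tt tt' dt dt'.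
Qed.

Lemma loc_jtrans (L : jet_space M -> R) tau c tau' c' z :
  time_coord tau -> atlas c -> time_coord tau' -> atlas c' ->
  joverlap tau c tau' c' z ->
  loc L tau c z = loc L tau' c' (jtrans tau c tau' c' z).
Proof. by move=> tt ac tt' ac' oz; rewrite /loc jpoint_jtrans. Qed.

Lemma regular_jtrans tau c tau' c' z :
  time_coord tau -> atlas c -> time_coord tau' -> atlas c' ->
  joverlap tau c tau' c' z ->
  regular_at (trans tau tau') (fun s => dtrans tau' tau (trans tau tau' s))
    (trans c c') (jac c c') z.
Proof.
move=> tt ac tt' ac' [zt zx].
have st := smooth_trans ac ac'.
have dth := differentiable_time_trans tt tt' zt.
split.
- exact: dth.
- exact: differentiable_comp dth (differentiable_dtrans tt' tt (trans_overlap zt)).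
- exact: dtransK tt tt' zt.
- exact: smooth_differentiable st zx.
- by move=> i j; exact: (smooth_differentiable (smooth_jac i j st) zx).
- move=> i j k.
  have sd := smooth_derive (delta_mx 0 k : 'rV[R]_n) (smooth_jac i j st).
  exact: (smooth_differentiable sd zx).
- by move=> u; apply: derive_trans; exact: smooth_differentiable st zx.
- by move=> i k j; exact: derive_jac_sym st zx.
Qed.

(** * The metric and the spray of a regular Lagrangian in one chart *)

Section lagrangian.
Variables (h : time_chart R -> R -> R) (L : jet_space M -> R).
Variable g : local_family M 'M[R]_n.
Hypothesis hm : semi_riemannian_metric h.
Hypothesis hL : kronecker_h_regular h L g.
Variables (tau : time_chart R) (c : chart 'rV[R]_n M).
Hypotheses (tt : time_coord tau) (ac : atlas c).
Notation l := (loc L tau c).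
Notation H z := (christoffel h tau z.1.1).

Lemma smooth_loc : smooth_on (jran tau c) l.
Proof. by have [sL _ _ _] := hL; exact: sL. Qed.

Lemma smooth_pd_y k : smooth_on (jran tau c) (pd_y k l).
Proof. exact: smooth_derive smooth_loc. Qed.

Lemma h_neq0 (z : jcoords R n) : jran tau c z -> h tau z.1.1 != 0.
Proof. by move=> [zt _]; exact: (hm.1 _ tt).2. Qed.

Lemma g_sym z : jran tau c z -> (g tau c z)^T = g tau c z.
Proof.
move=> zr; have [_ /(_ _ _ tt ac z zr)[_ [gs _]] _ _] := hL.
by apply/matrixP => i j; rewrite mxE.
Qed.

Lemma g_unit z : jran tau c z -> g tau c z \in unitmx.
Proof.
move=> zr; have [_ /(_ _ _ tt ac z zr)[_ [_ rk]] _ _] := hL.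
by rewrite -row_free_unit /row_free rk.
Qed.

Lemma hess_g z i j : jran tau c z ->
  pd_y i (pd_y j l) z = 2 * (h tau z.1.1)^-1 * g tau c z i j.
Proof.
move=> zr; have [_ /(_ _ _ tt ac z zr)[hess _] _ _] := hL.
by rewrite -mulrA -hess mulrA divff ?mul1r// pnatr_eq0.
Qed.

(** Regularity trades [2 h^11 g] for the Hessian; symmetry of [g] is used because the two formulas
    list its indices in opposite order. *)
Lemma spray_GE z : jran tau c z ->
  spray_G h L g tau c z = semispray (h tau z.1.1) (H z) (g tau c z) l z.
Proof.
move=> zr; apply/rowP => i; rewrite !mxE; apply: eq_bigr => k _.
congr (_ * (_ + _)); rewrite -mulrA mulrCA mulrA !mulr_sumr; apply: eq_bigr => m _.
rewrite (hess_g m k zr) -{1}(g_sym zr) mxE !mulrA.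
congr (_ * _ * _); exact: mulrC.
Qed.

Lemma differentiable_h (z : jcoords R n) : jran tau c z -> differentiable (h tau) z.1.1.
Proof. by move=> [zt _]; exact: smooth_differentiable (hm.1 _ tt).1 zt. Qed.

Lemma differentiable_christoffel (z : jcoords R n) : jran tau c z ->
  differentiable (christoffel h tau) z.1.1.
Proof.
move=> zr; have sh := (hm.1 _ tt).1.
have dd : differentiable (derive1 (h tau)) z.1.1.
  have -> : derive1 (h tau) = (fun s => 'D_1 (h tau) s).
    by apply/funext => s; rewrite derive1E.
  have sdh := smooth_derive (1 : R) sh.
  by case: zr => zt _; exact: (smooth_differentiable sdh zt).
apply: differentiable_mulf => //; apply: differentiable_mulf; last exact: differentiable_cst.
exact: (differentiableV (differentiable_h zr) (h_neq0 zr)).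
Qed.

(** The regularity of [g] is inherited from [L]: on the open set [jran tau c] it equals [h / 2]
    times the fibre Hessian of a smooth function. *)
Lemma differentiable_g z i j : jran tau c z ->
  differentiable (fun w => g tau c w i j) z.
Proof.
move=> zr; apply: (@near_eq_differentiable _ _ _
    (fun w => h tau w.1.1 * (2^-1 * pd_y i (pd_y j l) w))).
  have : \forall w \near z, jran tau c w.
    by apply: open_nbhs_nbhs; split => //; exact: open_jran.
  apply: filterS => w wr; rewrite (hess_g i j wr).
  have aux (x y : R) : x != 0 -> x * (2^-1 * (2 * x^-1 * y)) = y by move=> x0; field.
  by apply: aux; exact: h_neq0.
apply: differentiable_mulf; first exact: differentiable_tf (differentiable_h zr).
apply: differentiable_mulf; first exact: differentiable_cst.
exact: smooth_differentiable (smooth_derive _ (smooth_pd_y j)) zr.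
Qed.

Lemma differentiable_spray_G z i : jran tau c z ->
  differentiable (fun w => spray_G h L g tau c w 0 i) z.
Proof.
move=> zr; under eq_fun do rewrite mxE.
have dy k := @differentiable_y R n z k.
have dH := differentiable_tf (differentiable_christoffel zr).
have dh := differentiable_tf (differentiable_h zr).
have dl2 v k : differentiable (fun w => 'D_v (pd_y k l) w) z.
  exact: smooth_differentiable (smooth_derive v (smooth_pd_y k)) zr.
have dl k : differentiable (pd_y k l) z by exact: smooth_differentiable (smooth_pd_y k) zr.
have dlx v : differentiable (fun w => 'D_v l w) z.
  exact: smooth_differentiable (smooth_derive v smooth_loc) zr.
apply: differentiable_sumf => k _; apply: differentiable_mulf.
  apply: differentiable_mulf; last exact: differentiable_cst.
  apply: differentiable_mulf => //.
  apply: differentiable_invmx; last exact: g_unit.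
  by move=> *; exact: differentiable_g.
apply: differentiable_addf; last first.
  apply: differentiable_mulf.
    apply: differentiable_mulf => //; apply: differentiable_mulf.
      exact: differentiable_cst.
    exact: (differentiableV dh (h_neq0 zr)).
  by apply: differentiable_sumf => m _; apply: differentiable_mulf => //; exact: differentiable_g.
apply: differentiable_addf; last exact: differentiable_mulf.
apply: differentiable_addf; last exact: dl2.
apply: differentiable_addf; last by apply: differentiable_oppf; exact: dlx.
by apply: differentiable_sumf => j _; apply: differentiable_mulf => //; exact: dl2.
Qed.

End lagrangian.

(** The tensor law expresses the new [g] through the Jacobian of the inverse change; multiplying by
    [J] and [J^T] solves it for the old one, the form that [congr_invmx] expects. *)
Lemma g_congr h (L : jet_space M -> R) g tau c tau' c' z :
  kronecker_h_regular h L g ->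
  time_coord tau -> atlas c -> time_coord tau' -> atlas c' ->
  joverlap tau c tau' c' z ->
  g tau c z = jac c c' z.1.2 *m g tau' c' (jtrans tau c tau' c' z) *m (jac c c' z.1.2)^T.
Proof.
move=> [_ _ _ dg] tt ac tt' ac' oz.
have J1 := jac_mul ac ac' oz.2.
set J := jac c c' z.1.2 in J1 *; set J' := jac c' c _ in J1.
have -> : g tau' c' (jtrans tau c tau' c' z) = J' *m g tau c z *m J'^T.
  apply/matrixP => i j; rewrite (dg _ _ _ _ tt ac tt' ac' _ oz) !mxE.
  rewrite exchange_big; apply: eq_bigr => l _; rewrite !mxE mulr_suml.
  apply: eq_bigr => k _; exact: mulrAC.
by rewrite !mulmxA J1 mul1mx -mulmxA -trmx_mul J1 trmx1 mulmx1.
Qed.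

Lemma spray_G_jtrans h (L : jet_space M -> R) g tau c tau' c' z :
  semi_riemannian_metric h -> kronecker_h_regular h L g ->
  time_coord tau -> atlas c -> time_coord tau' -> atlas c' ->
  joverlap tau c tau' c' z ->
  spray_G h L g tau' c' (jtrans tau c tau' c' z) =
  dtrans tau' tau (trans tau tau' z.1.1) ^+ 2 *:
  (spray_G h L g tau c z *m jac c c' z.1.2 - 2^-1 *: hess_quad (jac c c') z).
Proof.
move=> hm hL tt ac tt' ac' oz.
have zr := joverlap_ran oz; have zr' := jtrans_ran oz.
rewrite (spray_GE hL tt ac zr) (spray_GE hL tt' ac' zr').
refine (@semispray_change _ _ (trans tau tau')
  (fun s => dtrans tau' tau (trans tau tau' s)) (trans c c') (jac c c')
  (joverlap tau c tau' c') (@open_joverlap tau c tau' c')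
  (fun w ow => regular_jtrans tt ac tt' ac' ow) (loc L tau c) (loc L tau' c')
  _ _ _ _ _ _ z (fun w ow => loc_jtrans L tt ac tt' ac' ow) _ _ oz
  (h_neq0 hm tt zr) (hm.2 _ _ tt tt' _ oz.1) (christoffel_trans hm tt tt' oz.1)
  _ (g_unit hL tt ac zr) (g_congr hL tt ac tt' ac' oz)
  (g_sym hL tt ac zr) (g_sym hL tt' ac' zr')
  (fun p m => hess_g hL tt' ac' p m zr')).
- by move=> w ow; exact: smooth_differentiable (smooth_loc hL tt' ac') (jtrans_ran ow).
- move=> k w ow.
  exact: smooth_differentiable (smooth_pd_y hL tt' ac' k) (jtrans_ran ow).
- exact: (mulmx1_unit (jac_mul ac ac' oz.2)).1.
Qed.

End jets.

Theorem theorem2p3p3 (R : realType) (n : nat) (M : smooth_manifold R n)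
    (h : time_chart R -> R -> R) (L : jet_space M -> R)
    (g : local_family M 'M[R]_n) :
  semi_riemannian_metric h ->
  kronecker_h_regular h L g ->
  let Mt : local_family M 'rV[R]_n :=
    fun tau c z => 2 *: spray_H h tau c z in
  let Ns : local_family M 'M[R]_n :=
    fun tau c z =>
      \matrix_(i, j) pd_y j (fun w => spray_G h L g tau c w 0 i) z in
  (forall tau c z i, Mt tau c z 0 i = - christoffel h tau z.1.1 * z.2 0 i) /\
  nonlinear_connection Mt Ns.
Proof.
move=> hm hL Mt Ns.
have MtE tau c z i : Mt tau c z 0 i = - christoffel h tau z.1.1 * z.2 0 i.
  have aux (x y : R) : 2 * (- 2^-1 * x * y) = - x * y by field.
  by rewrite !mxE aux.
split=> // tau c tau' c' tt ac tt' ac' z oz z' y' dt'dt dtdt' J; split=> [j|i j].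
- have rz := regular_jtrans tt ac tt' ac' oz.
  rewrite MtE /dt'dt /dtrans derive1E.
  (* At fixed position and velocity only the factor dt/dt' of the new fibre coordinate varies with
     time. *)
  have -> : pd_t (y' j) z = \sum_i J i j * 'D_1 (fun s =>
      dtrans tau' tau (trans tau tau' s)) z.1.1 * z.2 0 i.
    rewrite /pd_t /y'; under eq_fun do rewrite mxE.
    rewrite (derive_newy rz); apply: eq_bigr => i _ /=.
    by rewrite derive0 mul0r add0r mul1r [X in _ + _ * X]mxE mulr0 addr0.
  rewrite /= (christoffel_trans hm tt tt' oz.1) mxE mulr_sumr mulr_suml -sumrB.
  apply: eq_bigr => i _; rewrite MtE.
  (* The inhomogeneous part [a'] of the law of the Christoffel symbol is what supplies the time
     derivative of the new fibre coordinate. *)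
  have aux (a a' t x H y : R) : a * t = 1 ->
      - (a * H + a') * (x * a * y) * t = - H * y * a * x - x * a' * y.
    move=> at1; have -> : - (a * H + a') * (x * a * y) * t =
      (a * t) * (- H * y * a * x - x * a' * y) by ring.
    by rewrite at1 mul1r.
  exact: aux (reg_inv rz).
- have := @connection_change R n (trans tau tau')
    (fun s => dtrans tau' tau (trans tau tau' s)) (trans c c') (jac c c')
    (joverlap tau c tau' c') (@open_joverlap _ _ _ _ _ _ _)
    (fun w ow => regular_jtrans tt ac tt' ac' ow)
    (spray_G h L g tau c) (spray_G h L g tau' c') z i j oz.
  move=> /(_ (fun w ow => spray_G_jtrans hm hL tt ac tt' ac' ow)).
  move=> /(_ (fun k => differentiable_spray_G hm hL tt ac k (joverlap_ran oz))).
  move=> /(_ (fun w ow => differentiable_spray_G hm hL tt' ac' j (jtrans_ran ow))).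
  move=> E.
  rewrite (eq_bigr (fun k => pd_y k (fun w => spray_G h L g tau' c' w 0 j) z' * J i k));
    last by move=> k _; rewrite mxE.
  rewrite [X in _ = X - _](eq_bigr (fun k => pd_y i (fun w => spray_G h L g tau c w 0 k) z
    * dtdt' * J k j)); last by move=> k _; rewrite mxE.
  exact: E.
Qed.
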